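(* Let $A$ and $B$ be non-trivial recursively presented groups, where $B$ acts on a set $S$ such that there are a finite number $m$ of $B$-orbits in $S$, so $S=\bigsqcup_{k=1}^m S_k=\bigsqcup_{k=1}^m B/H_k$, where each $S_k$ is a $B$-orbit in $S$ and each $H_k$ is the stabiliser of some arbitrary point in $S_k$. The conjugacy problem in the permutational restricted wreath product $A\wr_S B$ is solvable if: (i) the conjugacy problem is solvable in $A$ and in $B$; (ii) either $A$ is abelian or the orbit order problem is solvable in $B$; (iii) for each $H_k$ the membership problem for $H_k\gamma\langle\beta\rangle$ (for any $\gamma,\beta\in B$) is solvable; and (iv) for any $\beta\in B$ and, for each $1\le k\le m$, any finite set of pairs $(\alpha_{k,i},\gamma_{k,i})$ with $\alpha_{k,i},\gamma_{k,i}\in B$, $1\le i\le n_k$, setting $$\Gamma_k:=\Big[\bigcap_{i=1}^{n_k}\alpha_{k,i}^{-1}H_k\gamma_{k,i}\langle\beta\rangle\Big]\cap C_B(\beta),$$ one can determine whether $\bigcap_{k=1}^m\Gamma_k=\emptyset$.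
   Context: A group is recursively presented if it has a presentation with finitely many generators and a recursively enumerable set of relators. Elements are given as words in the generators. The conjugacy problem is solvable if an algorithm decides, for any two words in the generators, whether they represent conjugate elements. $C_B(\beta)$ is the centraliser of $\beta$ in $B$. $B$ acts on $S$ on the right. For each $k$ fix a point $s_k\in S_k$ with stabiliser $H_k$ and identify $S_k$ with the set of right cosets $H_kt$ via $s_kt\leftrightarrow H_kt$. For $b\in B$, a $b$-orbit is an orbit of $\langle b\rangle$ on $S$. Permutational restricted wreath product: $A\wr_S B=\{(b,f): b\in B,\ f\in A^{(S)}\}$, where $A^{(S)}$ is the group (pointwise multiplication) of functions $f:S\to A$ with finite support, $f^{c}(s)=f(sc^{-1})$, and $(b,f)(c,g)=(bc,f^{c}g)$. It is generated by the elements $(b,1)$ with $b$ a generator of $B$ and $(1_B,a^{(s_k)})$ with $a$ a generator of $A$ and $1\le k\le m$, where $a^{(s)}$ takes the value $a$ at $s$ and $1_A$ elsewhere. Orbit order problem: decide, for any $b\in B$ and any $b$-orbit in $S$ (given by a representative $s_kt$, $t\in B$), whether that $b$-orbit is finite. Membership problem for $H_k\gamma\langle\beta\rangle$: there is an algorithm which, given words for $\gamma,\beta,w\in B$, decides whether $w\in H_k\gamma\langle\beta\rangle$. In (iv), ''can determine'' means there is an algorithm taking $\beta$ and all the pairs as input. The finite sets of pairs may be empty ($n_k=0$), the empty intersection being $B$. *)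

(* Defs.v *)
From HB Require Import structures.
From mathcomp Require Import finmap all_boot.
From mathcomp Require Import boolp classical_sets cardinality.

Set Implicit Arguments.
Unset Strict Implicit.
Unset Printing Implicit Defensive.

Local Open Scope classical_set_scope.
Local Open Scope group_scope.

(* Total recursive functions of several natural numbers: the least class that
   contains zero, successor and the projections and is closed under
   composition, primitive recursion and minimisation of regular functions
   (those for which the minimum exists for all arguments).  Restricting
   minimisation to regular functions gives exactly the total mu-recursive
   functions.  The function being built is characterised pointwise, so the
   class is closed under extensional equality. *)
Inductive recursive : forall k : nat, (k.-tuple nat -> nat) -> Prop :=
| rec_zero k : @recursive k (fun=> 0)
| rec_succ : @recursive 1 (fun v => (thead v).+1)
| rec_proj k (i : 'I_k) : @recursive k (fun v => tnth v i)
| rec_comp k l (f : l.-tuple nat -> nat) (g : 'I_l -> k.-tuple nat -> nat)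
    (h : k.-tuple nat -> nat) :
    recursive f -> (forall i, recursive (g i)) ->
    (forall v, h v = f [tuple g i v | i < l]) ->
    recursive h
| rec_primrec k (f : k.-tuple nat -> nat) (g : k.+2.-tuple nat -> nat)
    (h : k.+1.-tuple nat -> nat) :
    recursive f -> recursive g ->
    (forall v : k.-tuple nat, h [tuple of 0 :: v] = f v) ->
    (forall n (v : k.-tuple nat),
      h [tuple of n.+1 :: v] = g [tuple of n :: h [tuple of n :: v] :: v]) ->
    recursive h
| rec_mu k (f : k.+1.-tuple nat -> nat) (h : k.-tuple nat -> nat) :
    recursive f ->
    (forall v : k.-tuple nat, f [tuple of h v :: v] = 0) ->
    (forall (v : k.-tuple nat) i, i < h v -> f [tuple of i :: v] <> 0) ->
    recursive h.

(* Instances of a problem are numbered by [pickle].  It is only used at types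
   built from nat, ordinals, booleans, pairs, sums, lists and tuples, where it
   is obtained by iterating the arithmetic sequence coding [CodeSeq.code]. *)
Definition algorithmically_decidable (T : countType) (P : T -> Prop) : Prop :=
  exists chi : 1.-tuple nat -> nat,
    recursive chi /\ forall x : T, P x <-> chi [tuple pickle x] = 1%N.

Definition recursively_enumerable (T : countType) (P : T -> Prop) : Prop :=
  exists2 Q : T * nat -> Prop,
    algorithmically_decidable Q & forall x, P x <-> exists n, Q (x, n).

(* The letter (i, false) is the i-th generator, (i, true) is its inverse. *)
Definition word (I : Type) : Type := seq (I * bool).
HB.instance Definition _ (I : countType) := Countable.copy (word I) (seq (I * bool)).

Definition eval_word (I : Type) (G : groupType) (gen : I -> G) (w : word I) : G :=
  \prod_(l <- w) (if l.2 then (gen l.1)^-1 else gen l.1).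

(* The words that represent 1 in the group presented by the relators R: those
   obtained from the empty word by finitely many insertions and deletions of
   relators and of cancelling pairs of letters. *)
Inductive presented_trivial (I : Type) (R : word I -> Prop) : word I -> Prop :=
| pt_nil : presented_trivial R [::]
| pt_insert u r v :
    R r -> presented_trivial R (u ++ v) -> presented_trivial R (u ++ r ++ v)
| pt_delete u r v :
    R r -> presented_trivial R (u ++ r ++ v) -> presented_trivial R (u ++ v)
| pt_expand u i e v :
    presented_trivial R (u ++ v) ->
    presented_trivial R (u ++ [:: (i, e); (i, ~~ e)] ++ v)
| pt_cancel u i e v :
    presented_trivial R (u ++ [:: (i, e); (i, ~~ e)] ++ v) ->
    presented_trivial R (u ++ v).

(* [gen] is the generating family of a presentation of G that has finitely
   many generators and a recursively enumerable set of relators. *)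
Definition recursive_presentation (G : groupType) (n : nat) (gen : 'I_n -> G) : Prop :=
  exists2 R : word 'I_n -> Prop,
    recursively_enumerable R &
    (forall x : G, exists w, eval_word gen w = x) /\
    (forall w, eval_word gen w = 1 <-> presented_trivial R w).

Definition conjugacy_problem_solvable (I : countType) (G : groupType) (gen : I -> G) : Prop :=
  algorithmically_decidable (fun p : word I * word I =>
    exists x : G, eval_word gen p.2 = eval_word gen p.1 ^ x).

Definition cyclic_subgroup (G : groupType) (b : G) : set G :=
  [set x | exists n : nat, x = b ^+ n \/ x = b ^- n].

Definition centraliser (G : groupType) (b : G) : set G := [set x | commute x b].

Record right_action (B : groupType) (S : Type) := RightAction {
  ract :> S -> B -> S;
  ract1 : forall s, ract s 1 = s;
  ractM : forall s b c, ract s (b * c) = ract (ract s b) c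
}.

Section Actions.
Variables (B : groupType) (S : Type) (act : right_action B S).

Definition stabiliser (s : S) : set B := [set b | act s b = s].

Definition cyclic_orbit (b : B) (s : S) : set S :=
  [set act s c | c in cyclic_subgroup b].

(* Every B-orbit contains exactly one of the points s_k. *)
Definition orbit_representatives (m : nat) (s : 'I_m -> S) : Prop :=
  forall x : S, exists! k : 'I_m, exists t : B, x = act (s k) t.

(* H_s gamma <beta>, where H_s is the stabiliser of s. *)
Definition double_coset (s : S) (gamma beta : B) : set B :=
  [set h * gamma * c | h in stabiliser s & c in cyclic_subgroup beta].

(* The set Gamma_k for s = s_k; ps lists the pairs (alpha_{k,i}, gamma_{k,i}). *)
Definition Gamma (s : S) (beta : B) (ps : seq (B * B)) : set B :=
  (\bigcap_(p in [set` ps]) [set p.1^-1 * x | x in double_coset s p.2 beta])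
    `&` centraliser beta.

End Actions.

Section Problems.
Variables (B : groupType) (S : Type) (act : right_action B S).
Variables (n : nat) (gen : 'I_n -> B) (m : nat) (s : 'I_m -> S).

(* Input: a word for b, and k and a word for t, which give the point s_k t. *)
Definition orbit_order_problem_solvable : Prop :=
  algorithmically_decidable (fun p : word 'I_n * ('I_m * word 'I_n) =>
    finite_set (cyclic_orbit act (eval_word gen p.1)
                  (act (s p.2.1) (eval_word gen p.2.2)))).

(* Input: words for gamma, beta and w. *)
Definition double_coset_membership_solvable (k : 'I_m) : Prop :=
  algorithmically_decidable (fun p : word 'I_n * word 'I_n * word 'I_n =>
    double_coset act (s k) (eval_word gen p.1.1) (eval_word gen p.1.2)
      (eval_word gen p.2)).

(* Input: a word for beta and, for each k, a list of pairs of words. *)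
Definition Gamma_intersection_problem_solvable : Prop :=
  algorithmically_decidable
    (fun p : word 'I_n * m.-tuple (seq (word 'I_n * word 'I_n)) =>
      \bigcap_(k in [set: 'I_m])
        Gamma act (s k) (eval_word gen p.1)
          [seq (eval_word gen q.1, eval_word gen q.2) | q <- tnth p.2 k]
      = set0).

End Problems.

(* The action is a parameter of the type because the group law depends on it. *)
Record wreath (A B : groupType) (S : choiceType) (act : right_action B S) :=
  Wreath { wr_top : B; wr_base : {fsfun S -> A with 1} }.
Arguments Wreath {A B S act}.

Section Wreath.
Variables (A B : groupType) (S : choiceType) (act : right_action B S).
Local Notation base := {fsfun S -> A with 1}.
Local Notation wr := (wreath A act).
Local Open Scope fset_scope.

Definition wr_pair (x : wr) := (wr_top x, wr_base x).
Definition pair_wr (p : B * base) : wr := Wreath p.1 p.2.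
Lemma wr_pairK : cancel wr_pair pair_wr. Proof. by case. Qed.
HB.instance Definition _ := Choice.copy wr (can_type wr_pairK).

Definition base_one : base := [fsfun].
Definition base_mul (f g : base) : base :=
  [fsfun s in finsupp f `|` finsupp g => f s * g s].
Definition base_inv (f : base) : base := [fsfun s in finsupp f => (f s)^-1].
(* f^c : s |-> f (s c^-1) *)
Definition base_act (f : base) (c : B) : base :=
  [fsfun s in [fset act t c | t in finsupp f] => f (act s c^-1)].

Lemma base_oneE s : base_one s = 1. Proof. by rewrite fsfunE. Qed.

Lemma base_mulE f g s : base_mul f g s = f s * g s.
Proof.
by rewrite fsfunE in_fsetU; case: (finsuppP f); case: (finsuppP g) => //=;
  rewrite mul1g.
Qed.

Lemma base_invE f s : base_inv f s = (f s)^-1.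
Proof. by rewrite fsfunE; case: finsuppP => //= _; rewrite invg1. Qed.

Lemma base_actE f c s : base_act f c s = f (act s c^-1).
Proof.
rewrite fsfunE; case: ifPn => // /imfsetP sNf.
case: finsuppP => // sf; case: sNf; exists (act s c^-1) => //.
by rewrite -ractM mulVg ract1.
Qed.

Definition wr_one : wr := Wreath 1 base_one.
Definition wr_mul (x y : wr) : wr :=
  Wreath (wr_top x * wr_top y)
    (base_mul (base_act (wr_base x) (wr_top y)) (wr_base y)).
Definition wr_inv (x : wr) : wr :=
  Wreath (wr_top x)^-1 (base_inv (base_act (wr_base x) (wr_top x)^-1)).

Lemma wreathP (x y : wr) :
  wr_top x = wr_top y -> wr_base x =1 wr_base y -> x = y.
Proof. by case: x y => [b f] [c g] /= -> /fsfunP ->. Qed.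

Lemma wr_mulA : associative wr_mul.
Proof.
move=> x y z; apply: wreathP => [|s] /=; first by rewrite mulgA.
by rewrite !(base_mulE, base_actE) mulgA invgM ractM.
Qed.

Lemma wr_1mul : left_id wr_one wr_mul.
Proof.
move=> x; apply: wreathP => [|s] /=; first by rewrite mul1g.
by rewrite !(base_mulE, base_actE, base_oneE) mul1g.
Qed.

Lemma wr_mul1 : right_id wr_one wr_mul.
Proof.
move=> x; apply: wreathP => [|s] /=; first by rewrite mulg1.
by rewrite !(base_mulE, base_actE, base_oneE) mulg1 invg1 ract1.
Qed.

Lemma wr_Vmul : left_inverse wr_one wr_inv wr_mul.
Proof.
move=> x; apply: wreathP => [|s] /=; first by rewrite mulVg.
rewrite !(base_mulE, base_actE, base_invE, base_oneE) -ractM.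
by rewrite invgK mulVg ract1 mulVg.
Qed.

Lemma wr_mulV : right_inverse wr_one wr_inv wr_mul.
Proof.
move=> x; apply: wreathP => [|s] /=; first by rewrite mulgV.
by rewrite !(base_mulE, base_actE, base_invE, base_oneE) mulgV.
Qed.

HB.instance Definition _ :=
  isGroup.Build wr wr_mulA wr_1mul wr_mul1 wr_Vmul wr_mulV.

(* a^(s) *)
Definition base_delta (s : S) (a : A) : base := [fsfun t in [fset s] => a].

Definition wr_gen (nA nB m : nat) (genA : 'I_nA -> A) (genB : 'I_nB -> B)
    (s : 'I_m -> S) (i : 'I_nB + 'I_nA * 'I_m) : wr :=
  match i with
  | inl j => Wreath (genB j) base_one
  | inr (j, k) => Wreath 1 (base_delta (s k) (genA j))
  end.

End Wreath.

(* Main.v *)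
(* Conjugating by the top group reduces the problem to elements (c, f), (c, g)
   with the same top component.  Conjugation by elements (1, h) moves values
   along c-orbits, and conjugates them on finite c-orbits, so f and g may be
   taken to meet every c-orbit in at most one point.  The values are then
   determined up to conjugacy on finite orbits, and exactly on infinite ones
   (by the telescoping product along the orbit).  Hence (c, f) and (c, g) are
   conjugate iff some d in C_B(c) carries the c-orbits met by f onto those met
   by g with matching values.  As there are finitely many ways to pair these
   orbits, this is a finite disjunction of questions of the form (iv).

   No algorithm for computing the normal forms is needed: a normal form
   together with conjugating elements is a certificate that can be checked, and
   it is found by unbounded search. *)
Require Import Defs.
From mathcomp Require Import finmap all_boot.
From mathcomp Require Import boolp classical_sets cardinality.

Set Implicit Arguments.
Unset Strict Implicit.
Unset Printing Implicit Defensive.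

(** * Recursive functions on natural numbers *)

(** A certificate does not claim that the two given elements are conjugate: one exists as soon as
    their top components are conjugate, so the search ends on positive and negative instances alike,
    and the finite matching test decides afterwards. Checking a certificate needs equality tests.
    Words are compared through conjugacy of a quotient to 1, and points and orbits through (iii),
    since [w] lies in [H gamma <beta>] exactly when the points named by [gamma] and [w] share a
    [beta]-orbit. The gap between finite and infinite orbits comes from finite support. A
    conjugating function may be constant on a finite orbit, but on an infinite one it must be 1 far
    out in both directions, and this forces the values to be equal. On the recursion side the
    obstacle is that minimisation must be regular at every number, including numbers that code
    nothing; the decoders in [effective] serve this purpose. *)

Section NatFunctions.

(** Recursiveness is phrased as closure under substitution into recursive functions of any arity, so
    that argument tuples are handled only in a few introduction lemmas. *)
Definition rec1 (F : nat -> nat) := forall k (f : k.-tuple nat -> nat),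
  recursive f -> recursive (fun v => F (f v)).

Definition rec2 (F : nat -> nat -> nat) := forall k (f g : k.-tuple nat -> nat),
  recursive f -> recursive g -> recursive (fun v => F (f v) (g v)).

Definition rec3 (F : nat -> nat -> nat -> nat) :=
  forall k (f g h : k.-tuple nat -> nat),
  recursive f -> recursive g -> recursive h ->
  recursive (fun v => F (f v) (g v) (h v)).

Lemma rec1I F : recursive (fun v : 1.-tuple nat => F (tnth v ord0)) -> rec1 F.
Proof.
move=> rF k f rf; apply: (rec_comp (g := fun _ => f) rF) => // v.
by rewrite tnth_mktuple.
Qed.

Lemma rec2I F :
  recursive (fun v : 2.-tuple nat => F (tnth v ord0) (tnth v ord_max)) -> rec2 F.
Proof.
move=> rF k f g rf rg.
apply: (rec_comp (g := fun i : 'I_2 => if i == ord0 then f else g) rF).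
  by move=> i; case: ifP.
by move=> v; rewrite !tnth_mktuple.
Qed.

Lemma rec1_succ : rec1 S.
Proof. exact/rec1I/rec_succ. Qed.

Lemma rec_const c k : recursive (fun _ : k.-tuple nat => c).
Proof. by elim: c => [|c IH]; [apply: rec_zero | apply: rec1_succ]. Qed.

Lemma rec2_primrec F f g : rec1 f -> rec3 g ->
    (forall p, F 0 p = f p) -> (forall n p, F n.+1 p = g n (F n p) p) ->
  rec2 F.
Proof.
move=> rf rg F0 FS; apply: rec2I.
apply: (@rec_primrec 1 (fun v => f (tnth v ord0))
  (fun v => g (tnth v ord0) (tnth v (inord 1)) (tnth v (inord 2)))).
- by apply: rf; apply: rec_proj.
- by apply: rg; apply: rec_proj.
- by move=> v; rewrite F0; congr f; rewrite !(tnth_nth 0).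
move=> n v; rewrite (tnth_nth 0) FS.
by congr g; rewrite !(tnth_nth 0) /= ?inordK.
Qed.

Lemma rec1_primrec F c g : rec2 g ->
    F 0 = c -> (forall n, F n.+1 = g n (F n)) -> rec1 F.
Proof.
move=> rg F0 FS k f rf.
suff rF : rec2 (fun n _ => F n) by apply: (rF k f f).
apply: (@rec2_primrec _ (fun=> c) (fun n m _ => g n m)) => //.
  by move=> l h _; apply: rec_const.
by move=> l f1 f2 _ rf1 rf2 _; apply: rg.
Qed.

Lemma rec1_mu f h : rec2 f -> (forall p, f (h p) p = 0) ->
  (forall p i, i < h p -> f i p <> 0) -> rec1 h.
Proof.
move=> rf h0 hmin; apply: rec1I.
apply: (@rec_mu 1 (fun v => f (tnth v ord0) (tnth v ord_max))).
- by apply: rf; apply: rec_proj.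
- by move=> v; rewrite (tnth_nth 0) -[RHS](h0 (tnth v ord0)) !(tnth_nth 0).
move=> v i lih; have := hmin _ _ lih.
by rewrite !(tnth_nth 0).
Qed.

Lemma rec2_add : rec2 addn.
Proof.
apply: (@rec2_primrec _ id (fun _ a _ => a.+1)) => // k f g h _ rg _.
exact: rec1_succ.
Qed.

Lemma rec2_mul : rec2 muln.
Proof.
apply: (@rec2_primrec _ (fun=> 0) (fun _ a p => p + a)) => //.
  by move=> k f _; apply: rec_const.
by move=> k f g h _ rg rh; apply: rec2_add.
Qed.

Lemma rec1_pred : rec1 predn.
Proof. exact: (@rec1_primrec _ 0 (fun a _ => a)). Qed.

Lemma rec1_nz : rec1 (fun n => 0 < n : nat).
Proof.
by apply: (@rec1_primrec _ 0 (fun _ _ => 1)) => // k *; apply: rec_const.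
Qed.

Lemma rec1_iszero : rec1 (fun n => n == 0 : nat).
Proof.
by apply: (@rec1_primrec _ 1 (fun _ _ => 0)) => // k *; apply: rec_const.
Qed.

Lemma rec1_eqc c : rec1 (fun n => n == c : nat).
Proof.
elim: c => [|c IH]; first exact: rec1_iszero.
move=> k f rf.
have -> : (fun v => f v == c.+1 : nat) =
    (fun v => muln (0 < f v) ((f v).-1 == c)).
  by apply/funext => v; case: (f v) => // n; rewrite mul1n eqSS.
by apply: rec2_mul; [apply: rec1_nz | apply: IH; apply: rec1_pred].
Qed.

Lemma rec3_cond : rec3 (fun b x y => if b == 1 then x else y).
Proof.
move=> k f g h rf rg rh.
have -> : (fun v => if f v == 1 then g v else h v) =
    (fun v => (f v == 1) * g v + ((f v == 1 : nat) == 0) * h v).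
  by apply/funext => v; case: eqP; rewrite ?mul1n ?mul0n ?addn0.
apply: rec2_add; apply: rec2_mul => //; first exact: rec1_eqc.
exact/rec1_iszero/rec1_eqc.
Qed.

Lemma rec1_odd : rec1 (fun n => odd n : nat).
Proof.
apply: (@rec1_primrec _ 0 (fun _ b => b == 0)) => //.
  by move=> k f g _; apply: rec1_iszero.
by move=> n /=; case: odd.
Qed.

Lemma rec1_half : rec1 half.
Proof.
apply: (@rec1_primrec _ 0 (fun n h => odd n + h)) => //.
  by move=> k f g rf rg; apply: rec2_add => //; apply: rec1_odd.
by move=> n; rewrite [LHS]uphalf_half.
Qed.

Lemma rec1_exp2 : rec1 (fun n => 2 ^ n).
Proof.
apply: (@rec1_primrec _ 1 (fun _ e => e + e)) => //.
  by move=> k f g _ rg; apply: rec2_add.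
by move=> n; rewrite expnS mul2n addnn.
Qed.

Lemma rec2_iter g : rec1 g -> rec2 (fun n p => iter n g p).
Proof.
move=> rg; apply: (@rec2_primrec _ id (fun _ a _ => g a)) => //.
by move=> k f1 f2 f3 _ rf _; apply: rg.
Qed.

(* The code of n :: l, where c is the code of l. *)
Definition consc n c := 2 ^ n * c.*2.+1.

Lemma consc_gt0 n c : 0 < consc n c.
Proof. by rewrite muln_gt0 expn_gt0. Qed.

Lemma rec2_consc : rec2 consc.
Proof.
move=> k f g rf rg; apply: rec2_mul; first exact: rec1_exp2.
have -> : (fun v => (g v).*2.+1) = (fun v => (g v + g v).+1).
  by apply/funext => v; rewrite addnn.
by apply: rec1_succ; apply: rec2_add.
Qed.

(** Halving strips factors 2, so the first odd iterate appears after as many steps as the exponent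
    of 2 in [c], which is the head of the coded list. The disjunct [c == 0] keeps the search regular
    and gives [headc 0 = 0]. *)
Lemma ex_odd_half c : exists i, (c == 0) || odd (iter i half c).
Proof.
elim/ltn_ind: c => c IH; case: (boolP (odd c)) => oc.
  by exists 0; rewrite /= oc orbT.
case: (posnP c) => [->|c0]; first by exists 0.
have [|i] := IH c./2.
  by rewrite ltn_half_double -addnn -[ltnLHS]add0n ltn_add2r.
have -> : (c./2 == 0) = false.
  apply/eqP => h0; move: oc c0; rewrite -[c in 0 < c]odd_double_half h0.
  by case: odd.
by rewrite orFb => oi; exists i.+1; rewrite iterSr oi orbT.
Qed.

Definition headc c := ex_minn (ex_odd_half c).
Definition tailc c := (iter (headc c) half c)./2.

Lemma iter_half_consc n c : iter n half (consc n c) = c.*2.+1.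
Proof.
elim: n => [|n IH]; first by rewrite /consc mul1n.
by rewrite iterSr /consc expnS -mulnA mul2n doubleK.
Qed.

Lemma headc_cons n c : headc (consc n c) = n.
Proof.
rewrite /headc; case: ex_minnP => i.
rewrite eqn0Ngt consc_gt0 /= => oi mini.
apply/eqP; rewrite eqn_leq mini; last first.
  by rewrite iter_half_consc /= odd_double.
rewrite leqNgt; apply/negP => lin; move: oi.
rewrite /consc -(subnKC lin) addSn -addnS expnD -mulnA.
have -> : forall m, iter i half (2 ^ i * m) = m.
  elim: i {lin mini} => [|i IH] m; first by rewrite mul1n.
  by rewrite iterSr expnS -mulnA mul2n doubleK.
by rewrite expnS -mulnA mul2n odd_double.
Qed.

Lemma tailc_cons n c : tailc (consc n c) = c.
Proof. by rewrite /tailc headc_cons iter_half_consc /= uphalf_double. Qed.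

Lemma rec1_headc : rec1 headc.
Proof.
apply: (@rec1_mu (fun i c => ((c == 0) + odd (iter i half c) == 0)%N)).
- move=> k f g rf rg; apply/rec1_iszero/rec2_add; first exact: rec1_iszero.
  by apply/rec1_odd/rec2_iter => //; apply: rec1_half.
- by rewrite /headc => c; case: ex_minnP => i; case: eqP; case: odd.
rewrite /headc => c i; case: ex_minnP => j _ minj lij.
by have := contraNN (minj i); rewrite -ltnNge lij => /(_ isT); case: eqP; case: odd.
Qed.

Lemma rec1_tailc : rec1 tailc.
Proof.
move=> k f rf; apply: rec1_half.
by apply: (rec2_iter rec1_half) => //; apply: rec1_headc.
Qed.

End NatFunctions.

(** * Computable functions between countable types *)

Section Computable.

(** [F] is constrained only on codes. This is enough for composition, but not for minimisation. *)
Definition computable (T U : countType) (f : T -> U) : Prop :=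
  exists2 F, rec1 F & forall x, F (pickle x) = pickle (f x).

Implicit Types T U V X Y : countType.

Lemma decidable_computable T (P : T -> Prop) :
  algorithmically_decidable P <-> computable (fun x => `[< P x >]).
Proof.
split=> [[chi [rchi chiP]]|[F rF FP]].
  exists (fun n => chi [tuple n] == 1 : nat) => [|x].
    move=> k f rf; apply: rec1_eqc.
    apply: (rec_comp (g := fun _ => f) rchi) => // v; congr chi.
    by apply: eq_from_tnth => i; rewrite tnth_mktuple !(tnth_nth 0) ord1.
  by congr nat_of_bool; apply/eqP/asboolP => /chiP.
exists (fun v => F (tnth v ord0)); split=> [|x].
  by apply: rF; apply: rec_proj.
rewrite (tnth_nth 0) /= FP.
change (P x <-> `[< P x >] = 1 :> nat).
by split=> [/asboolT -> //|]; case: asboolP.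
Qed.

Lemma comp_ext T U (f g : T -> U) : f =1 g -> computable f -> computable g.
Proof. by move=> fg [F rF FP]; exists F => // x; rewrite FP fg. Qed.

Lemma comp_id T : computable (fun x : T => x).
Proof. by exists id. Qed.

Lemma comp_const T U (u : U) : computable (fun _ : T => u).
Proof. by exists (fun=> pickle u) => // k f _; apply: rec_const. Qed.

Lemma comp_comp T U V (g : U -> V) (f : T -> U) :
  computable g -> computable f -> computable (fun x => g (f x)).
Proof.
move=> [G rG GP] [F rF FP]; exists (fun n => G (F n)) => [k h rh|x].
  exact/rG/rF.
by rewrite FP GP.
Qed.

Definition pairc a b := consc a (consc b 0).
Definition fstc := headc.
Definition sndc c := headc (tailc c).

Lemma fstcE a b : fstc (pairc a b) = a. Proof. exact: headc_cons. Qed.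
Lemma sndcE a b : sndc (pairc a b) = b.
Proof. by rewrite /sndc tailc_cons headc_cons. Qed.

Lemma pickle_pairE T U (p : T * U) :
  pickle p = pairc (pickle p.1) (pickle p.2).
Proof. by []. Qed.

Lemma pickle_consE T x (s : seq T) : pickle (x :: s) = consc (pickle x) (pickle s).
Proof. by []. Qed.

Lemma rec2_pairc : rec2 pairc.
Proof.
move=> k f g rf rg; apply: rec2_consc => //; apply: rec2_consc => //.
exact: rec_const.
Qed.

Lemma rec1_sndc : rec1 sndc.
Proof. by move=> k f rf; apply/rec1_headc/rec1_tailc. Qed.

Lemma comp_pair T U V (f : T -> U) (g : T -> V) :
  computable f -> computable g -> computable (fun x => (f x, g x)).
Proof.
move=> [F rF FP] [G rG GP]; exists (fun n => pairc (F n) (G n)) => [k h rh|x].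
  by apply: rec2_pairc; [apply: rF | apply: rG].
by rewrite FP GP.
Qed.

Lemma comp_fst T U V (f : T -> U * V) :
  computable f -> computable (fun x => (f x).1).
Proof.
apply: (@comp_comp _ _ _ (fun p => p.1)).
by exists fstc => [|x]; [apply: rec1_headc | rewrite pickle_pairE fstcE].
Qed.

Lemma comp_snd T U V (f : T -> U * V) :
  computable f -> computable (fun x => (f x).2).
Proof.
apply: (@comp_comp _ _ _ (fun p => p.2)).
by exists sndc => [|x]; [apply: rec1_sndc | rewrite pickle_pairE sndcE].
Qed.

(** The programs [F i] may be given separately, with no uniformity in [i]: a finite cascade of
    comparisons with constant codes combines them. This lets (iii) be assumed for one [k] at a
    time. *)
Lemma comp_case (I : finType) T U (F : I -> T -> U) (g : T -> I) :
  (forall i, computable (F i)) -> computable g -> computable (fun x => F (g x) x).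
Proof.
move=> cF cg.
suff cF' : computable (fun p : I * T => F p.1 p.2).
  exact: (comp_comp cF' (comp_pair cg (comp_id T))).
have [G rG GP] : exists2 G, rec1 G & forall i x, i \in enum I ->
    G (pairc (pickle i) (pickle x)) = pickle (F i x).
  elim: (enum I) => [|i s [G rG GP]].
    by exists (fun=> 0) => // k f _; apply: rec_const.
  have [Fi rFi FiP] := cF i.
  exists (fun n => if (fstc n == pickle i : nat) == 1 then Fi (sndc n) else G n).
    move=> k f rf; apply: rec3_cond; last exact: rG.
      exact/rec1_eqc/rec1_headc.
    exact/rFi/rec1_sndc.
  move=> j x; rewrite fstcE sndcE in_cons.
  case: (eqVneq j i) => [-> _|nij /= js]; first by rewrite eqxx FiP.
  by rewrite (inj_eq (pcan_inj (@pickleK I))) (negPf nij) GP.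
by exists G => // -[i x]; rewrite pickle_pairE GP // mem_enum.
Qed.

Lemma comp_finfun (I : finType) T U (h : I -> U) (g : T -> I) :
  computable g -> computable (fun x => h (g x)).
Proof.
by apply: (comp_case (F := fun i _ => h i)) => i; apply: comp_const.
Qed.

Lemma comp_fin2 (I J : finType) T U (h : I -> J -> U) (f : T -> I) (g : T -> J) :
  computable f -> computable g -> computable (fun x => h (f x) (g x)).
Proof.
move=> cf cg.
by apply: (comp_case (F := fun i x => h i (g x))) => // i; apply: comp_finfun.
Qed.

Lemma comp_if T U (b : T -> bool) (f g : T -> U) : computable b ->
  computable f -> computable g -> computable (fun x => if b x then f x else g x).
Proof.
move=> cb cf cg.
by apply: (comp_case (F := fun b x => if b then f x else g x)) => // -[].
Qed.

Lemma comp_cons T U (f : T -> U) (g : T -> seq U) :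
  computable f -> computable g -> computable (fun x => f x :: g x).
Proof.
move=> [F rF FP] [G rG GP]; exists (fun n => consc (F n) (G n)) => [k h rh|x].
  by apply: rec2_consc; [apply: rF | apply: rG].
by rewrite FP GP.
Qed.

Lemma size_code s : size s <= CodeSeq.code s.
Proof.
elim: s => //= n s IH; apply: (leq_ltn_trans IH).
apply: (@leq_trans (1 * (CodeSeq.code s).*2.+1)).
  by rewrite mul1n ltnS -addnn leq_addl.
by rewrite leq_mul2r expn_gt0 orbT.
Qed.

(* The state st is the code of the pair of the list still to be read and the
   accumulator. *)
Definition foldl_step (G : nat -> nat) p st :=
  if (fstc st == 0 : nat) == 1 then st
  else pairc (tailc (fstc st)) (G (pairc p (pairc (headc (fstc st)) (sndc st)))).

Lemma rec2_foldl_step G : rec1 G -> rec2 (foldl_step G).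
Proof.
move=> rG k p st rp rst.
have rfst : recursive (fun v => fstc (st v)) by apply: rec1_headc.
apply: rec3_cond => //; first exact: rec1_eqc.
apply: rec2_pairc; first exact: rec1_tailc.
apply: rG; apply: rec2_pairc => //; apply: rec2_pairc; first exact: rec1_headc.
exact: rec1_sndc.
Qed.

(** The step is iterated as many times as the code of the list, which bounds its length by
    [size_code]; surplus steps leave an exhausted state unchanged. *)
Lemma comp_foldl T X U (g : T -> U -> X -> U) (z : T -> U) (s : T -> seq X) :
  computable (fun q : T * (X * U) => g q.1 q.2.2 q.2.1) ->
  computable z -> computable s -> computable (fun x => foldl (g x) (z x) (s x)).
Proof.
move=> [G rG GP] [Z rZ ZP] [C rC CP].
pose L n p := iter n (foldl_step G p) (pairc (C p) (Z p)).
have rL : rec2 L.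
  apply: (@rec2_primrec _ (fun p => pairc (C p) (Z p))
            (fun _ st p => foldl_step G p st)) => // [k f rf|k f h j _ rh rj].
    by apply: rec2_pairc; [apply: rC | apply: rZ].
  exact: rec2_foldl_step.
exists (fun p => sndc (L (C p) p)) => [k f rf|x].
  by apply/rec1_sndc/rL => //; apply: rC.
have run n (l : seq X) u : size l <= n ->
    iter n (foldl_step G (pickle x)) (pairc (pickle l) (pickle u)) =
    pairc 0 (pickle (foldl (g x) u l)).
  elim: n l u => [|n IH] [|y l] u // ln.
    rewrite iterSr {2}/foldl_step fstcE eqxx /=.
    exact: (IH [::]).
  rewrite iterSr {2}/foldl_step fstcE pickle_consE.
  rewrite eqn0Ngt consc_gt0 /= tailc_cons headc_cons sndcE.
  by rewrite (GP (x, (y, u))) IH.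
rewrite /L CP ZP run ?sndcE //.
by apply: leq_trans (size_code _); rewrite size_map.
Qed.

Lemma comp_rev T U (s : T -> seq U) :
  computable s -> computable (fun x => rev (s x)).
Proof.
move=> cs; apply: (comp_ext (f := fun x => foldl (fun a y => y :: a) [::] (s x))).
  by move=> x; rewrite /rev; elim: (s x) [::] => /=.
apply: (comp_foldl (g := fun _ a y => y :: a)) => //; last exact: comp_const.
apply: comp_cons; first exact/comp_fst/comp_snd/comp_id.
exact/comp_snd/comp_snd/comp_id.
Qed.

Lemma comp_foldr T X U (g : T -> X -> U -> U) (z : T -> U) (s : T -> seq X) :
  computable (fun q : T * (X * U) => g q.1 q.2.1 q.2.2) ->
  computable z -> computable s -> computable (fun x => foldr (g x) (z x) (s x)).
Proof.
move=> cg cz cs.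
apply: (comp_ext (f := fun x => foldl (fun u y => g x y u) (z x) (rev (s x)))).
  by move=> x; rewrite foldl_rev.
by apply: (comp_foldl (g := fun x u y => g x y u)) => //; apply: comp_rev.
Qed.

End Computable.

Ltac comp_step :=
  lazymatch goal with
  | |- computable (fun x => x) => apply: comp_id
  | |- computable fst => apply: (comp_fst (f := id)); apply: comp_id
  | |- computable snd => apply: (comp_snd (f := id)); apply: comp_id
  | |- computable (fun x => fst (@?f x)) => apply: (comp_fst (f := f))
  | |- computable (fun x => snd (@?f x)) => apply: (comp_snd (f := f))
  | |- computable (fun x => (@?f x, @?g x)) => apply: (comp_pair (f := f) (g := g))
  | |- computable (fun x => @?f x :: @?g x) => apply: (comp_cons (f := f) (g := g))
  | |- computable (fun x => foldr (@?f x) (@?z x) (@?s x)) =>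
      apply: (comp_foldr (g := f) (z := z) (s := s)); rewrite /=
  | |- computable (fun _ => ?c) => apply: comp_const
  end.
Ltac comp_auto := repeat (try eassumption; comp_step).

(** * Programs on lists, decoders and unbounded search *)

Section Derived.

Implicit Types T U V X Y : countType.

Lemma comp_andb T (b c : T -> bool) :
  computable b -> computable c -> computable (fun x => b x && c x).
Proof. exact: comp_fin2. Qed.

Lemma comp_orb T (b c : T -> bool) :
  computable b -> computable c -> computable (fun x => b x || c x).
Proof. exact: comp_fin2. Qed.

Lemma comp_negb T (b : T -> bool) :
  computable b -> computable (fun x => ~~ b x).
Proof. exact: comp_finfun. Qed.

Lemma comp_all T X (p : T -> X -> bool) (s : T -> seq X) :
  computable (fun q => p q.1 q.2) -> computable s ->
  computable (fun x => all (p x) (s x)).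
Proof.
move=> cp cs.
apply: (comp_ext (f := fun x => foldr (fun y b => p x y && b) true (s x))) => //.
comp_step; try comp_auto.
apply: comp_andb; last by comp_auto.
by apply: (comp_comp (f := fun q => (q.1, q.2.1)) cp); comp_auto.
Qed.

Lemma comp_has T X (p : T -> X -> bool) (s : T -> seq X) :
  computable (fun q => p q.1 q.2) -> computable s ->
  computable (fun x => has (p x) (s x)).
Proof.
move=> cp cs.
apply: (comp_ext (f := fun x => ~~ all (fun y => ~~ p x y) (s x))) => [x|].
  by rewrite -[RHS]negbK -all_predC.
by apply: comp_negb; apply: comp_all => //; apply: (comp_negb (b := fun q => p q.1 q.2)).
Qed.

Lemma comp_cat T X (r s : T -> seq X) :
  computable r -> computable s -> computable (fun x => r x ++ s x).
Proof.
move=> cr cs.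
apply: (comp_ext (f := fun x => foldr (fun y l => y :: l) (s x) (r x))).
  by move=> x; elim: (r x) => //= y l ->.
by comp_auto.
Qed.

Lemma comp_map T X Y (h : T -> X -> Y) (s : T -> seq X) :
  computable (fun q => h q.1 q.2) -> computable s ->
  computable (fun x => map (h x) (s x)).
Proof.
move=> ch cs.
apply: (comp_ext (f := fun x => foldr (fun y l => h x y :: l) [::] (s x))).
  by move=> x; elim: (s x) => //= y l ->.
comp_auto.
by apply: (comp_comp (f := fun q => (q.1, q.2.1)) ch); comp_auto.
Qed.

Lemma comp_filter T X (p : T -> X -> bool) (s : T -> seq X) :
  computable (fun q => p q.1 q.2) -> computable s ->
  computable (fun x => filter (p x) (s x)).
Proof.
move=> cp cs.
apply: (comp_ext (f := fun x =>
    foldr (fun y l => if p x y then y :: l else l) [::] (s x))).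
  by move=> x; elim: (s x) => //= y l ->.
comp_auto; apply: comp_if; comp_auto.
by apply: (comp_comp (f := fun q => (q.1, q.2.1)) cp); comp_auto.
Qed.

Lemma comp_flatten T X (s : T -> seq (seq X)) :
  computable s -> computable (fun x => flatten (s x)).
Proof.
move=> cs.
apply: (comp_ext (f := fun x => foldr (fun l r => l ++ r) [::] (s x))) => //.
by comp_step; try comp_auto; apply: comp_cat; comp_auto.
Qed.

(** A number is itself the code of the list of numbers that it decodes to, so the identity computes
    the decoder. *)
Lemma comp_decode T (f : T -> nat) :
  computable f -> computable (fun x => CodeSeq.decode (f x)).
Proof.
apply: comp_comp; exists id => // n.
by rewrite /pickle /= /pickle_seq map_id CodeSeq.decodeK.
Qed.

Lemma comp_eqc T c (f : T -> nat) :
  computable f -> computable (fun x => f x == c).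
Proof.
apply: (comp_comp (g := fun n => n == c)).
by exists (fun n => n == c : nat) => //; apply: rec1_eqc.
Qed.

Lemma comp_head T X x0 (s : T -> seq X) :
  computable s -> computable (fun x => head x0 (s x)).
Proof.
move=> cs; apply: (comp_ext (f := fun x => foldr (fun y _ => y) x0 (s x))).
  by move=> x; case: (s x).
by comp_auto.
Qed.

(** Kleene's trick for the predecessor: the fold carries a list together with its tail. *)
Lemma comp_behead T X (s : T -> seq X) :
  computable s -> computable (fun x => behead (s x)).
Proof.
move=> cs; apply: (comp_ext (f := fun x =>
    (foldr (fun y lr => (y :: lr.1, lr.1)) ([::], [::]) (s x)).2)).
  move=> x; have H l : foldr (fun (y : X) lr => (y :: lr.1, lr.1)) ([::], [::]) l =
    (l, behead l) by elim: l => //= y l ->.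
  by rewrite H.
by comp_auto.
Qed.

(* Nothing is required of u off the range of pickle. *)
Definition effective T := exists2 u : nat -> seq T,
  computable u & forall x, u (pickle x) = [:: x].

Lemma effective_fin (I : finType) : effective I.
Proof.
exists (fun n => [seq i <- enum I | n == pickle i]) => [|i].
  elim: (enum I) => [|i s IH] /=; first exact: comp_const.
  by apply: comp_if; comp_auto; apply: comp_eqc; comp_auto.
rewrite (eq_filter (a2 := pred1 i)).
  by rewrite filter_pred1_uniq ?enum_uniq ?mem_enum.
by move=> j /=; rewrite (inj_eq (pcan_inj (@pickleK I))) eq_sym.
Qed.

Lemma effective_seq T : effective T -> effective (seq T).
Proof.
move=> [u cu uK]; exists (fun n => [:: flatten (map u (CodeSeq.decode n))]) => [|s].
  comp_auto; apply/comp_flatten/comp_map; last by apply: comp_decode; comp_auto.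
  by apply: (comp_comp cu); comp_auto.
rewrite [pickle s]/(CodeSeq.code _) CodeSeq.codeK -map_comp.
by congr [:: _]; elim: s => //= x s ->; rewrite uK.
Qed.

Lemma effective_pair T U : effective T -> effective U -> effective (T * U)%type.
Proof.
move=> [u cu uK] [v cv vK].
pose l1 n := head 0 (CodeSeq.decode n).
pose l2 n := head 0 (behead (CodeSeq.decode n)).
exists (fun n => flatten [seq [seq (x, y) | y <- v (l2 n)] | x <- u (l1 n)]).
  have c1 : computable l1 by apply/comp_head/comp_decode/comp_id.
  have c2 : computable l2 by apply/comp_head/comp_behead/comp_decode/comp_id.
  apply/comp_flatten/comp_map; last exact: comp_comp cu c1.
  apply: comp_map; first by comp_auto.
  by apply: (comp_comp cv); apply: (comp_comp c2); comp_auto.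
move=> [x y]; rewrite /l1 /l2.
have -> : CodeSeq.decode (pickle (x, y)) = [:: pickle x; pickle y].
  exact: (CodeSeq.codeK [:: pickle x; pickle y]).
by rewrite /= uK vK.
Qed.

Lemma comp_search T (Q : T -> nat -> bool) (h : T -> nat) :
  effective T -> computable (fun p => Q p.1 p.2) ->
  (forall x, Q x (h x)) -> (forall x n, Q x n -> h x <= n) ->
  computable h.
Proof.
move=> [u cu uK] cQ Qh hmin.
(* Each fold keeps only the value at the first decoded element. If [k] decodes to nothing, the
   default [true] stops the search at 0, which is the default value in [h']. *)
pose R (n k : nat) := foldr (fun x _ => Q x n) true (u k).
have [G rG GP] : computable (fun p : nat * nat => R p.1 p.2).
  apply: comp_foldr; last 2 first.
  - exact: comp_const.
  - by apply: (comp_comp cu); comp_auto.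
  by apply: (comp_comp (f := fun q => (q.2.1, q.1.1)) cQ); comp_auto.
pose h' k := foldr (fun x _ => h x) 0 (u k).
exists h'; last by move=> x; rewrite /h' uK.
apply: (@rec1_mu (fun n k => G (pairc n k) == 0)).
- move=> k f g rf rg; apply: rec1_iszero; apply: rG.
  exact: rec2_pairc.
- move=> k; rewrite (GP (h' k, k)) /R /h' /=.
  by case: (u k) => //= x s; rewrite Qh.
move=> k n; rewrite (GP (n, k)) /R /h' /=.
case: (u k) => //= x s lnh; have := hmin x n.
by case: (Q x n) => // /(_ isT); rewrite leqNgt lnh.
Qed.

(** The search is for a number that decodes to a valid certificate. As every instance has one,
    whether or not [P] holds, the search is total and [P] is decided rather than merely
    enumerated. *)
Lemma decidable_search T (C : countType) (P : T -> Prop) (V D : T -> C -> bool) :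
  effective T -> effective C ->
  computable (fun p => V p.1 p.2) -> computable (fun p => D p.1 p.2) ->
  (forall x, exists c, V x c) ->
  (forall x c, V x c -> P x <-> D x c) ->
  algorithmically_decidable P.
Proof.
move=> eT [u cu uK] cV cD exV VD; apply/decidable_computable.
pose Q x n := has (V x) (u n).
have exQ x : exists n, Q x n.
  by have [c Vc] := exV x; exists (pickle c); rewrite /Q uK /= Vc.
pose h x := ex_minn (exQ x).
have cQ : computable (fun p => Q p.1 p.2).
  apply: comp_has; last by apply: (comp_comp cu); comp_auto.
  by apply: (comp_comp (f := fun q => (q.1.1, q.2)) cV); comp_auto.
have ch : computable h.
  apply: (comp_search eT cQ) => [x|x n]; rewrite /h; case: ex_minnP => // m _.
  exact.
apply: (comp_ext (f := fun x => has (fun c => V x c && D x c) (u (h x)))).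
  move=> x; apply/hasP/asboolP => [[c _ /andP[Vc Dc]]|Px]; first exact/(VD x c).
  have /hasP[c cu' Vc] : Q x (h x) by rewrite /h; case: ex_minnP.
  by exists c => //; rewrite Vc; apply/VD.
apply: comp_has; last exact: comp_comp cu ch.
exact: comp_andb.
Qed.

End Derived.

(** * Conjugation by the base group *)

Section TwistedConjugacy.

Local Open Scope group_scope.

Variables (A B : groupType) (S : choiceType) (act : right_action B S).
Implicit Types (f g h : S -> A) (b c d : B) (p q s : S).

Definition finitely_supported f := exists L : seq S, forall p, f p <> 1 -> p \in L.

(* (b, f) and (b, g) are conjugate by an element (1, h) of the base group. *)
Definition base_conj b f g := exists2 h, finitely_supported h &
  forall s, f s * h s = h (act s b^-1) * g s.

Lemma base_conj_refl b f : base_conj b f f.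
Proof.
by exists (fun=> 1) => [|s]; [exists [::] | rewrite mulg1 mul1g].
Qed.

Lemma base_conj_sym b f g : base_conj b f g -> base_conj b g f.
Proof.
move=> [h [L hL] fhg]; exists (fun s => (h s)^-1).
  by exists L => p hp; apply: hL => h1; apply: hp; rewrite h1 invg1.
move=> s; apply: (mulgI (h (act s b^-1))); apply: (mulIg (h s)).
by rewrite !mulgA mulgV mul1g mulgVK -fhg.
Qed.

Lemma base_conj_trans b f g k :
  base_conj b f g -> base_conj b g k -> base_conj b f k.
Proof.
move=> [h [L hL] fhg] [h' [L' hL'] ghk]; exists (fun s => h s * h' s).
  exists (L ++ L') => p hp; rewrite mem_cat.
  have [h1|/eqP/hL ->//] := eqVneq (h p) 1.
  by rewrite hL' ?orbT // => h1'; apply: hp; rewrite h1 h1' mulg1.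
by move=> s; rewrite mulgA fhg -mulgA ghk mulgA.
Qed.

Lemma actK b : cancel (act^~ b) (act^~ b^-1).
Proof. by move=> s; rewrite -ractM mulgV ract1. Qed.

Lemma actVK b : cancel (act^~ b^-1) (act^~ b).
Proof. by move=> s; rewrite -ractM mulVg ract1. Qed.

Lemma act_inj b : injective (act^~ b).
Proof. exact: can_inj (actK b). Qed.

Definition upd f p (a : A) := fun s => if s == p then a else f s.

Lemma upd_same f p a : upd f p a p = a.
Proof. by rewrite /upd eqxx. Qed.

Lemma upd_other f p a s : s != p -> upd f p a s = f s.
Proof. by rewrite /upd => /negPf ->. Qed.

(** The conjugating function is [(f p)^-1] at [p] and 1 elsewhere. It cancels the value at [p]; its
    translate by [b] sits at [act p b] and is compensated there by the left factor [f p]. At a fixed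
    point of [b] the two effects would coincide and merely conjugate the value. *)
Lemma base_conj_move b f p : act p b != p ->
  base_conj b f (upd (upd f p 1) (act p b) (f p * f (act p b))).
Proof.
move=> pb; exists (upd (fun=> 1) p (f p)^-1).
  by exists [:: p] => s; rewrite /upd inE; case: eqP.
move=> s; case: (eqVneq s p) => [->|sp].
  rewrite upd_same mulgV upd_other; last first.
    by apply/eqP => e; move/eqP: pb; apply; rewrite -{1}e actVK.
  by rewrite mul1g upd_other 1?eq_sym // upd_same.
rewrite upd_other // mulg1; case: (eqVneq s (act p b)) => [->|spb].
  by rewrite actK !upd_same mulKg.
rewrite !upd_other ?mul1g //.
by apply/eqP => e; move/eqP: spb; apply; rewrite -e actVK.
Qed.

(* Two exponents, to avoid negative powers. *)
Definition same_orbit b p q := exists i j, act q (b ^+ i) = act p (b ^+ j).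

Lemma same_orbit_refl b p : same_orbit b p p.
Proof. by exists 0, 0. Qed.

Lemma same_orbit_sym b p q : same_orbit b p q -> same_orbit b q p.
Proof. by move=> [i [j e]]; exists j, i. Qed.

Lemma same_orbit_trans b p q r :
  same_orbit b p q -> same_orbit b q r -> same_orbit b p r.
Proof.
move=> [i [j e]] [k [l e']]; exists (k + i), (l + j).
by rewrite expgnDr ractM e' -ractM -expgnDr addnC expgnDr ractM e -ractM -expgnDr addnC.
Qed.

Lemma same_orbit_act b p i : same_orbit b p (act p (b ^+ i)).
Proof. by exists 0, i; rewrite expg0 ract1. Qed.

Lemma same_orbit_actV b p i : same_orbit b p (act p (b ^- i)).
Proof. by exists i, 0; rewrite expg0 ract1 -ractM mulVg ract1. Qed.

Lemma same_orbit_cyclic b p q :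
  same_orbit b p q <-> cyclic_orbit act b p q.
Proof.
split=> [[i [j e]]|[c [n [] ->] <-]]; last 2 first.
- exact: same_orbit_act.
- exact: same_orbit_actV.
have -> : q = act p (b ^+ j * b ^- i).
  by rewrite ractM -e -ractM mulgV ract1.
exists (b ^+ j * b ^- i) => //; case: (leqP i j) => [ij|/ltnW ji].
  by exists (j - i)%N; left; rewrite expgnFr.
by exists (i - j)%N; right; rewrite expgnFr // invgM invgK.
Qed.

Lemma same_orbit_commute b d p q : commute d b ->
  same_orbit b p q -> same_orbit b (act p d) (act q d).
Proof.
move=> db [i [j e]]; exists i, j.
by rewrite -!ractM (commuteX i db) (commuteX j db) !ractM e.
Qed.

Definition periodic b p := exists2 n, 0 < n & act p (b ^+ n) = p.

Lemma periodic_expM b p n k : act p (b ^+ n) = p -> act p (b ^+ (k * n)) = p.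
Proof.
move=> e; elim: k => [|k IH]; first by rewrite expg0 ract1.
by rewrite mulSn expgnDr ractM e.
Qed.

Lemma periodic_mod b p n i : act p (b ^+ n) = p ->
  act p (b ^+ i) = act p (b ^+ (i %% n)).
Proof.
by move=> e; rewrite {1}(divn_eq i n) expgnDr ractM periodic_expM.
Qed.

Lemma periodic_orbit b p q n : 0 < n -> act p (b ^+ n) = p ->
  same_orbit b p q -> exists2 i, i < n & q = act p (b ^+ i).
Proof.
move=> n0 e /same_orbit_cyclic[c [k [] ->] <-].
  by exists (k %% n)%N; [rewrite ltn_mod | apply: periodic_mod].
(* As [n] is positive, [k * n] is a multiple of the period not below [k], so [k * n - k] is a
   natural exponent standing for [-k]. *)
exists ((k * n - k) %% n)%N; first by rewrite ltn_mod.
rewrite -periodic_mod // expgnFr ?leq_pmulr //.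
by rewrite ractM periodic_expM.
Qed.

Lemma not_periodic_inj b p i j : ~ periodic b p ->
  act p (b ^+ i) = act p (b ^+ j) -> i = j.
Proof.
move=> np; wlog ij : i j / i <= j => [W|].
  by case: (leqP i j) => [|/ltnW] ij e; [apply: W | symmetry; apply: W].
move=> e; apply/eqP; rewrite eqn_leq ij leqNgt; apply/negP => lij.
apply: np; exists (j - i)%N; first by rewrite subn_gt0.
by rewrite expgnFr // ractM -e -ractM mulgV ract1.
Qed.

Lemma injective_notin (e : nat -> S) (L : seq S) : injective e ->
  exists n, e n.+1 \notin L.
Proof.
move=> inj_e; apply: contrapT => /forallNP eL.
suff : size (map e (iota 1 (size L).+1)) <= size L.
  by rewrite size_map size_iota ltnn.
apply: uniq_leq_size; first by rewrite map_inj_uniq ?iota_uniq.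
move=> s /mapP[[|i]]; rewrite mem_iota // => _ ->.
by have /negP := eL i; rewrite negbK.
Qed.

Lemma finite_orbit_periodic b p :
  cardinality.finite_set (cyclic_orbit act b p) <-> periodic b p.
Proof.
split=> [/cardinality.finite_seqP[L orbL]|[n n0 e]].
  apply: contrapT => np.
  have [n /negP[]] : exists n, act p (b ^+ n.+1) \notin L.
    apply: (@injective_notin (fun n => act p (b ^+ n))) => i j.
    exact: not_periodic_inj.
  have : cyclic_orbit act b p (act p (b ^+ n.+1)).
    by apply/same_orbit_cyclic/same_orbit_act.
  by rewrite orbL.
apply: (@cardinality.sub_finite_set _ _
          (fun q => q \in [seq act p (b ^+ i) | i <- iota 0 n])) => [q|].
  move=> /same_orbit_cyclic /(periodic_orbit n0 e)[i lin ->] /=.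
  by apply/mapP; exists i; rewrite ?mem_iota.
exact: cardinality.finite_seq.
Qed.

(* Conjugation by the base group can replace a value a at p by a' at any point
   of the b-orbit of p exactly under this condition. *)
Definition slot_equiv b p (a a' : A) :=
  (exists u, a' = a ^ u) /\ (~ periodic b p -> a = a').

Definition trivial_on_orbit b f p := forall q, same_orbit b p q -> f q = 1.

Lemma base_conj_act b f p a i : trivial_on_orbit b f p ->
  base_conj b (upd f p a) (upd f (act p (b ^+ i)) a).
Proof.
move=> f1; elim: i => [|i IH]; first by rewrite ract1; apply: base_conj_refl.
apply: base_conj_trans IH _; rewrite expgSr ractM.
have : same_orbit b p (act p (b ^+ i)) by apply: same_orbit_act.
move: (act p _) => q pq.
have [->|qb] := eqVneq (act q b) q; first exact: base_conj_refl.
have := base_conj_move (upd f q a) qb; rewrite upd_same upd_other //.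
rewrite (f1 (act q b)) ?mulg1; last first.
  by apply: same_orbit_trans pq _; rewrite -[b in act q b]expg1; apply: same_orbit_act.
congr base_conj; apply/funext => s; rewrite /upd; case: eqP => // _.
by case: eqP => // ->; rewrite f1.
Qed.

(** On a finite orbit the constant function [u] has finite support, and conjugating by it turns [a]
    into [a ^ u] while fixing the values 1. On an infinite orbit [slot_equiv] gives [a = a'], and
    only the position has to be moved. *)
Lemma base_conj_slot b f p q a a' : trivial_on_orbit b f p ->
  same_orbit b p q -> slot_equiv b p a a' -> base_conj b (upd f p a) (upd f q a').
Proof.
move=> f1 pq [[u au] infa]; apply: (@base_conj_trans _ _ (upd f p a')); last first.
  have [i [j e]] := pq.
  apply: base_conj_trans (base_conj_act a' j f1) _; rewrite -e.
  apply/base_conj_sym/base_conj_act => s qs.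
  by apply: f1; apply: same_orbit_trans qs.
have [[n n0 e]|/infa->] := pselect (periodic b p); last exact: base_conj_refl.
exists (fun s => if `[< same_orbit b p s >] then u else 1).
  exists [seq act p (b ^+ i) | i <- iota 0 n] => s.
  case: asboolP => // /(periodic_orbit n0 e)[i lin ->] _.
  by apply/mapP; exists i; rewrite ?mem_iota.
move=> s; have -> : `[< same_orbit b p (act s b^-1) >] = `[< same_orbit b p s >].
  apply: asbool_equiv_eq; have ss' : same_orbit b s (act s b^-1).
    by rewrite -[b in b^-1]expg1; apply: same_orbit_actV.
  split=> /same_orbit_trans; apply => //; exact: same_orbit_sym.
case: asboolP => [ps|nps].
  rewrite /upd; case: eqP => _; first by rewrite au conjgE mulVKg.
  by rewrite f1 // mul1g mulg1.
by rewrite mulg1 mul1g !upd_other //; apply/eqP => e'; apply: nps;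
  rewrite e' //; apply: same_orbit_refl.
Qed.

Definition separated b f := forall p q, f p <> 1 -> f q <> 1 ->
  same_orbit b p q -> p = q.

Definition matched b f g := forall p, f p <> 1 ->
  exists q, [/\ g q <> 1, same_orbit b p q & slot_equiv b p (f p) (g q)].

(** Induction on a list containing the support points of [f] at which [f] and [g] differ. One step
    moves the value at such a point to its partner and turns it into the value of [g], so the point
    leaves the list. For the empty list [f] agrees with [g] on its support; the last hypothesis and
    separation then exclude further support points of [g]. *)
Lemma matched_base_conj b f g : finitely_supported f ->
  separated b f -> separated b g -> matched b f g ->
  (forall q, g q <> 1 -> exists2 p, f p <> 1 & same_orbit b p q) ->
  base_conj b f g.
Proof.
move=> [L fL] sepf sepg fg gf.
have {fL} : forall p, f p <> 1 -> f p <> g p -> p \in L by move=> p /fL.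
elim: L => [|p L IH] in f sepf fg gf * => mis.
  have fgE p : f p <> 1 -> f p = g p by move=> fp; apply: contrapT => /(mis p fp).
  have -> : f = g; last exact: base_conj_refl.
  apply/funext => q; have [gq|] := pselect (g q <> 1).
    have [p fp pq] := gf q gq.
    have gp : g p <> 1 by rewrite -(fgE p fp).
    by rewrite -(sepg p q gp gq pq) (fgE p fp).
  move=> /contrapT gq; rewrite gq; apply: contrapT => fq; have := fgE q fq.
  by rewrite gq.
have [ok|/not_implyP[fp fgp]] := pselect (f p <> 1 -> f p = g p).
  apply: IH => // q fq fgq; have := mis q fq fgq.
  by rewrite inE => /orP[/eqP qp|//]; rewrite qp in fq fgq; case: fgq; apply: ok.
have [q [gq pq fgq]] := fg p fp.
pose f0 := upd f p 1.
have f0p : trivial_on_orbit b f0 p.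
  move=> s ps; rewrite /f0 /upd; case: eqP => // /eqP sp; apply: contrapT => fs.
  by move/eqP: sp; apply; symmetry; apply: sepf.
have -> : f = upd f0 p (f p).
  by apply/funext => s; rewrite /f0 /upd; case: eqP => // ->.
apply: base_conj_trans (base_conj_slot f0p pq fgq) _.
have f'q : upd f0 q (g q) q = g q by rewrite upd_same.
have f's s : upd f0 q (g q) s <> 1 -> s = q \/ [/\ s != q, s != p,
    f s <> 1 & upd f0 q (g q) s = f s].
  rewrite /f0 /upd; case: eqP => [|_]; first by left.
  by case: eqP => // _; right.
have nopq s : f s <> 1 -> s != p -> ~ same_orbit b s q.
  move=> fs /eqP sp sq; apply: sp; apply: sepf => //.
  exact/(same_orbit_trans sq)/same_orbit_sym.
apply: IH.
- move=> s t /f's[->|[sq sp fs _]] /f's[->|[tq tp ft _]] // st.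
  + by case: (nopq t) => //; apply: same_orbit_sym.
  + by case: (nopq s).
  exact: sepf.
- move=> s /f's[->|[sq sp fs ->]]; last exact: fg.
  exists q; split=> //; first exact: same_orbit_refl.
  rewrite f'q; split=> //; exists 1; by rewrite conjg1.
- move=> t gt; have [s fs st] := gf t gt.
  have [sp|sp] := eqVneq s p.
    exists q; rewrite ?f'q // -(sepg q t) //; first exact: same_orbit_refl.
    by apply: same_orbit_trans (same_orbit_sym pq) _; rewrite -sp.
  exists s => //; rewrite /f0 /upd (negPf sp).
  by case: eqP => // sq; rewrite sq in st.
move=> s /f's[->|[sq sp fs ->]]; first by rewrite f'q.
by move=> fgs; have := mis s fs fgs; rewrite inE (negPf sp).
Qed.

(** * Orbit values as invariants of base conjugacy *)

Lemma prod_single n (F : nat -> A) i : i < n ->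
  (forall j, j < n -> F j <> 1 -> j = i) -> \prod_(0 <= j < n) F j = F i.
Proof.
move=> lin Fi; rewrite (big_cat_nat (n := i)) ?(ltnW lin) //= (big_ltn lin).
have F1 k l : (forall j, k <= j < l -> j < n /\ j != i) ->
    \prod_(k <= j < l) F j = 1.
  move=> kl; rewrite big_nat big1 // => j /kl[jn /eqP ji].
  by apply: contrapT => /(Fi j jn).
rewrite !F1 ?mulg1 ?mul1g // => j /andP[].
  by move=> ij jn; rewrite jn gtn_eqF.
by move=> _ ji; rewrite (ltn_trans ji lin) ltn_eqF.
Qed.

Lemma base_conj_telescope b f g h s n :
    (forall s, f s * h s = h (act s b^-1) * g s) ->
  \prod_(0 <= i < n) f (act s (b ^+ i.+1)) * h (act s (b ^+ n)) =
  h s * \prod_(0 <= i < n) g (act s (b ^+ i.+1)).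
Proof.
move=> fhg; elim: n => [|n IH]; first by rewrite !big_nil ract1 mul1g mulg1.
have E : f (act s (b ^+ n.+1)) * h (act s (b ^+ n.+1)) =
    h (act s (b ^+ n)) * g (act s (b ^+ n.+1)).
  by rewrite fhg -ractM {1}expgSr mulgK.
by rewrite !big_nat_recr //= -mulgA E !mulgA IH.
Qed.

(* The products of f and g over the window s b, ..., s b^n have at most one
   nontrivial factor each, and telescoping conjugates them by h s. *)
Lemma base_conj_window b f g h s n i : separated b f -> separated b g ->
    (forall s, f s * h s = h (act s b^-1) * g s) ->
    i < n -> f (act s (b ^+ i.+1)) <> 1 ->
    (forall j k, j < n -> k < n ->
      act s (b ^+ j.+1) = act s (b ^+ k.+1) -> j = k) ->
    h (act s (b ^+ n)) = h s ->
  exists q, [/\ g q <> 1, same_orbit b (act s (b ^+ i.+1)) q &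
    g q = f (act s (b ^+ i.+1)) ^ h s].
Proof.
move=> sepf sepg fhg lin fi inj hn.
have orb j k : same_orbit b (act s (b ^+ j)) (act s (b ^+ k)).
  by apply: same_orbit_trans (same_orbit_act b s k); apply/same_orbit_sym/same_orbit_act.
have := base_conj_telescope s n fhg.
rewrite hn (prod_single (i := i)) // => [E|j lj fj]; last first.
  by apply: inj => //; apply: sepf.
have [j lj gj] : exists2 j, j < n & g (act s (b ^+ j.+1)) <> 1.
  apply: contrapT => H; apply: fi; apply: (mulIg (h s)).
  rewrite E mul1g big_nat big1 ?mulg1 // => j /= lj.
  by apply: contrapT => gj; apply: H; exists j.
exists (act s (b ^+ j.+1)); split=> //.
rewrite conjgE E (prod_single (i := j)) ?mulKg // => k lk gk.
by apply: inj => //; apply: sepg.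
Qed.

(** On a finite orbit the window is one least period, so [h] takes the same value at both ends and
    conjugates the values. On an infinite orbit the window ends, on both sides of [p], at points
    where [h] is 1, so the values are equal. *)
Lemma base_conj_matched b f g : separated b f -> separated b g ->
  base_conj b f g -> matched b f g.
Proof.
move=> sepf sepg [h [L hL] fhg] p fp.
have [[n0 n00 e0]|np] := pselect (periodic b p).
  have ex : exists n, (0 < n) && (act p (b ^+ n) == p).
    by exists n0; rewrite n00 e0 eqxx.
  (* The least period is [n.+1]; the window of that length after [p] ends at [p], which thus has
     index [n]. Minimality makes its points distinct. *)
  case: (ex_minnP ex) => -[//|n] /= /eqP e minn.
  have [|||q [gq pq gqE]] := @base_conj_window b f g h p n.+1 n sepf sepg fhg (ltnSn n).
  - by rewrite e.
  - move=> i j; wlog ij : i j / i <= j => [W|] lin ljn E.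
      by case: (leqP i j) => [|/ltnW] ij; [|symmetry]; apply: W.
    apply/eqP; rewrite eqn_leq ij leqNgt; apply/negP => lij.
    have := minn (j.+1 - i.+1)%N.
    rewrite subSS subn_gt0 lij /= -subSS expgnFr // ractM -E -ractM mulgV ract1.
    rewrite eqxx => /(_ isT); rewrite subSS leqNgt ltnS.
    by rewrite (leq_trans (leq_subr _ _)).
  - by rewrite e.
  rewrite e in pq gqE; exists q; split=> //; split; first by exists (h p).
  by case; exists n.+1.
have np' q : same_orbit b p q -> ~ periodic b q.
  move=> /same_orbit_cyclic[c [k cE] <-] [n n0]; rewrite -!ractM.
  have -> : c * b ^+ n = b ^+ n * c.
    apply: commuteX; apply: commute_sym.
    by case: cE => ->; [|apply: commuteV]; apply: commuteX.
  by rewrite ractM => /act_inj e; apply: np; exists n.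
have [M hM] : exists M, h (act p (b ^- M.+1)) = 1.
  have [|M ML] := @injective_notin (fun i => act p (b ^- i)) L.
    move=> i j /= e; apply: (not_periodic_inj np).
    rewrite -(mulKg (b ^+ j) (b ^+ i)) ractM -e -ractM.
    by rewrite (commuteX2 j i (commute_refl b)) mulKg.
  by exists M; apply: contrapT => /hL; apply/negP.
have [N hN] : exists N, h (act p (b ^+ N.+1)) = 1.
  have [|N NL] := @injective_notin (fun i => act p (b ^+ i)) L.
    by move=> i j; apply: not_periodic_inj.
  by exists N; apply: contrapT => /hL; apply/negP.
have pE : act (act p (b ^- M.+1)) (b ^+ M.+1) = p by rewrite -ractM mulVg ract1.
have [||||q [gq pq gqE]] :=
    @base_conj_window b f g h (act p (b ^- M.+1)) (M.+1 + N.+1) M sepf sepg fhg.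
- by rewrite addSn ltnS leq_addr.
- by rewrite pE.
- move=> i j _ _ e; apply: succn_inj.
  by apply: not_periodic_inj e; apply/np'/same_orbit_actV.
- by rewrite expgnDr ractM pE hN hM.
rewrite pE in pq gqE; rewrite hM conjg1 in gqE.
by exists q; split=> //; split=> //; exists 1; rewrite conjg1.
Qed.

(** If two support points [p] and [q] share an orbit, the value at [p] is pushed towards [q] one
    step at a time. Either it meets a listed point and the list shrinks (outer induction), or it
    lands on a free point and the distance to [q] drops while the length of the list does not grow
    (inner induction). *)
Lemma base_conj_separated b f : finitely_supported f ->
  exists2 g, finitely_supported g & separated b g /\ base_conj b f g.
Proof.
move=> [L fL]; have [n] := ubnP (size L).
elim: n => // n IH in f L fL *; rewrite ltnS => Ln.
have [sepf|] := pselect (separated b f).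
  by exists f; [exists L | split=> //; apply: base_conj_refl].
have step i f' L' p q : (forall s, f' s <> 1 -> s \in L') -> size L' <= n ->
    f' p <> 1 -> f' q <> 1 -> p != q -> q = act p (b ^+ i) ->
    exists2 g, finitely_supported g & separated b g /\ base_conj b f' g.
  elim: i => [|i IHi] in f' L' p * => f'L' L'n f'p f'q pq.
    by rewrite ract1 => e; rewrite e eqxx in pq.
  rewrite expgS ractM => e.
  have [pb|pb] := eqVneq (act p b) p.
    by case/eqP: pq; rewrite e pb -[i]muln1 periodic_expM // expg1.
  have cf' := base_conj_move f' pb; set f2 := upd _ _ _ in cf'.
  have L'p : size [seq s <- L' | s != p] < size L'.
    rewrite size_filter -(count_predC (pred1 p)) addnC -addn1.
    by rewrite leq_add2l -has_count has_pred1 f'L'.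
  have f2s s : f2 s <> 1 -> s = act p b \/ s != p /\ f' s <> 1.
    by rewrite /f2 /upd; case: eqP => [|_]; [left | case: eqP => // _; right].
  have [pbL|pbL] := boolP (act p b \in L').
    have [||g gfin [gsep f2g]] := IH f2 [seq s <- L' | s != p].
    - move=> s /f2s[->|[sp f's]]; rewrite mem_filter ?pb //.
      by rewrite sp f'L'.
    - exact: leq_trans L'p L'n.
    by exists g => //; split=> //; apply: base_conj_trans f2g.
  have f'pb : f' (act p b) = 1 by apply: contrapT => /f'L'; apply/negP.
  have qpb : act p b != q by apply/eqP => e'; rewrite e' in f'pb.
  have [||||||g gfin [gsep f2g]] := IHi f2 (act p b :: [seq s <- L' | s != p]) (act p b).
  - move=> s /f2s[->|[sp f's]]; rewrite inE ?eqxx //.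
    by rewrite mem_filter sp f'L' ?orbT.
  - exact: leq_trans L'p L'n.
  - by rewrite /f2 upd_same f'pb mulg1.
  - by rewrite /f2 !upd_other // eq_sym.
  - by [].
  - by [].
  by exists g => //; split=> //; apply: base_conj_trans f2g.
move=> /existsNP[p] /existsNP[q] /not_implyP[fp] /not_implyP[fq].
move=> /not_implyP[[i [j e]] /eqP pq].
have eV : q = act (act p (b ^+ j)) (b ^- i) by rewrite -e -ractM mulgV ract1.
(* The sign of the exponent decides which of the two points is pushed towards the other. *)
case: (leqP i j) => ij.
  apply: (step (j - i)%N f L p q) => //.
  by rewrite eV -ractM expgnFr.
apply: (step (i - j)%N f L q p) => //; first by rewrite eq_sym.
by rewrite eV -!ractM expgnFr ?(ltnW ij) // !mulgA mulgVK mulgV ract1.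
Qed.

(** An element commuting with [b] permutes the [b]-orbits and preserves their finiteness, so
    translation keeps [f] separated and leaves [slot_equiv] unchanged. Then [d] enters only through
    which orbit is carried to which, the form required by (iv). *)
Lemma base_conj_shift b d f g :
  finitely_supported f -> separated b f -> separated b g -> commute d b ->
  base_conj b (fun s => f (act s d^-1)) g <->
  (forall p, f p <> 1 -> exists q,
     [/\ g q <> 1, same_orbit b (act p d) q & slot_equiv b p (f p) (g q)]) /\
  (forall q, g q <> 1 -> exists2 p, f p <> 1 & same_orbit b (act p d) q).
Proof.
move=> [L fL] sepf sepg db; set f' := fun s => _.
have db' : commute d^-1 b by apply/commute_sym/commuteV/commute_sym.
have per p : periodic b (act p d) <-> periodic b p.
  suff H c r : commute c b -> periodic b r -> periodic b (act r c).
    by split=> [/(H d^-1 _ db')|]; rewrite ?actK //; apply: H.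
  by move=> cb [n n0 e]; exists n => //; rewrite -ractM (commuteX n cb) ractM e.
have slotE p a a' : slot_equiv b (act p d) a a' <-> slot_equiv b p a a'.
  by rewrite /slot_equiv; split=> -[u H]; split=> // np; apply: H => /per.
have f'L : finitely_supported f'.
  exists [seq act p d | p <- L] => s /fL; rewrite -{2}(actVK d s).
  exact: map_f.
have sepf' : separated b f'.
  move=> p q f'p f'q pq; apply: (can_inj (actVK d)).
  by apply: sepf => //; apply: same_orbit_commute.
split=> [fg|[fg gf]].
  split=> [p fp|q gq].
    have [|q [gq pq fgq]] := base_conj_matched sepf' sepg fg (p := act p d).
      by rewrite /f' actK.
    rewrite /f' actK in fgq.
    by exists q; split=> //; apply/slotE.
  have [p [f'p qp _]] := base_conj_matched sepg sepf' (base_conj_sym fg) gq.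
  by exists (act p d^-1); rewrite ?actVK //; apply: same_orbit_sym.
apply: matched_base_conj => // [p f'p|q gq].
  have [q [gq pq fgq]] := fg _ f'p.
  rewrite actVK in pq; exists q; split=> //; rewrite -(actVK d p).
  by apply/slotE; rewrite actVK.
by have [p fp pq] := gf q gq; exists (act p d) => //; rewrite /f' actK.
Qed.

Lemma base_conj_translate b d f g : commute d b -> base_conj b f g ->
  base_conj b (fun s => f (act s d^-1)) (fun s => g (act s d^-1)).
Proof.
move=> db [h [L hL] fhg]; exists (fun s => h (act s d^-1)).
  exists [seq act p d | p <- L] => s /hL; rewrite -{2}(actVK d s).
  exact: map_f.
by move=> s; rewrite fhg -!ractM -!invgM db.
Qed.

Lemma wreath_conjP (x y : wreath A act) :
  (exists z, y = x ^ z) <->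
  exists2 d, wr_top x * d = d * wr_top y &
    base_conj (wr_top y) (fun s => wr_base x (act s d^-1)) (wr_base y).
Proof.
have zP z : y = x ^ z <-> x * z = z * y.
  split=> [->|e]; first by rewrite conjgC.
  by rewrite conjgE e mulKg.
split=> [[z /zP E]|[d E [h [L hL] fhg]]].
  exists (wr_top z).
    have E1 : wr_top (x * z) = wr_top (z * y) by rewrite E.
    exact: E1.
  exists (wr_base z).
    exists (finsupp (wr_base z)) => p zp.
    have : p \in finsupp (wr_base z) by rewrite mem_finsupp; apply/eqP.
    exact.
  move=> s; have E2 : wr_base (x * z) s = wr_base (z * y) s by rewrite E.
  by rewrite -base_actE -base_mulE E2 base_mulE base_actE.
pose h' : {fsfun S -> A with 1} := [fsfun s in [fset t | t in L]%fset => h s].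
have h'E s : h' s = h s.
  rewrite fsfunE; case: ifPn => // /negP sL.
  apply: contrapT => hs; apply: sL.
  by apply/imfsetP; exists s => //; apply: hL => /esym.
exists (Wreath d h'); apply/zP; apply: wreathP => //= s.
by rewrite !base_mulE !base_actE !h'E fhg.
Qed.

End TwistedConjugacy.

(** * The decision procedure *)

Section Program.

Local Open Scope group_scope.

Variables (A B : groupType) (nA nB : nat) (genA : 'I_nA -> A) (genB : 'I_nB -> B).
Variables (S : choiceType) (act : right_action B S) (m : nat) (s : 'I_m -> S).

Local Notation WA := (seq ('I_nA * bool)).
Local Notation WB := (seq ('I_nB * bool)).
Local Notation point := ('I_m * WB)%type.
Local Notation entry := (point * WA)%type.
Local Notation evA w := (eval_word genA w).
Local Notation evB w := (eval_word genB w).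
Local Notation letter := (('I_nB + 'I_nA * 'I_m) * bool)%type.

Implicit Types (T : countType) (a : WA) (b c d : WB) (q r : point) (e : entry).
Implicit Types (L M : seq entry) (p : S).

Lemma eval_cat (I : Type) (G : groupType) (gen : I -> G) u v :
  eval_word gen (u ++ v) = eval_word gen u * eval_word gen v.
Proof. by rewrite /eval_word big_cat. Qed.

Lemma eval_nil (I : Type) (G : groupType) (gen : I -> G) : eval_word gen [::] = 1.
Proof. by rewrite /eval_word big_nil. Qed.

Lemma eval_cons (I : Type) (G : groupType) (gen : I -> G) l w :
  eval_word gen (l :: w) =
  (if l.2 then (gen l.1)^-1 else gen l.1) * eval_word gen w.
Proof. by rewrite /eval_word big_cons. Qed.

Definition inverse_word (I : Type) (w : seq (I * bool)) :=
  [seq (l.1, ~~ l.2) | l <- rev w].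

Lemma eval_inverse (I : Type) (G : groupType) (gen : I -> G) w :
  eval_word gen (inverse_word w) = (eval_word gen w)^-1.
Proof.
rewrite /eval_word /inverse_word big_map -[in RHS](revK w) -prodgV; apply: eq_bigr => -[i []] _ //=.
by rewrite invgK.
Qed.

Definition pt q : S := act (s q.1) (evB q.2).

(** Several entries may name one point, as words for points are not unique. Such entries are
    multiplied in list order, so that concatenation of lists is pointwise multiplication
    ([lval_cat]). *)
Definition lval L p : A := \prod_(e <- L | pt e.1 == p) evA e.2.

Lemma lval_cat L M p : lval (L ++ M) p = lval L p * lval M p.
Proof. by rewrite /lval big_cat. Qed.

Lemma lval_notin L p : lval L p <> 1 -> exists2 e, e \in L & pt e.1 = p.
Proof.
move=> Lp; apply: contrapT => H; apply: Lp.
rewrite /lval big_seq_cond big1 // => e /andP[eL /eqP ep].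
by case: H; exists e.
Qed.

Lemma lval_finite L : finitely_supported (lval L).
Proof.
exists [seq pt e.1 | e <- L] => p /lval_notin[e eL <-].
exact: (map_f (fun e => pt e.1)).
Qed.

Definition shift L d := [seq ((e.1.1, e.1.2 ++ d), e.2) | e <- L].

Lemma lval_shift L d p : lval (shift L d) p = lval L (act p (evB d)^-1).
Proof.
rewrite /lval /shift big_map; apply: eq_bigl => e.
rewrite /pt /= eval_cat ractM; apply/eqP/eqP => [<-|->]; first by rewrite actK.
by rewrite actVK.
Qed.

Definition eqA a a' := `[< evA a = evA a' >].
Definition same_point q r := `[< pt q = pt r >].
Definition word_at L q : WA := flatten [seq e.2 | e <- L & same_point e.1 q].

Lemma eval_word_at L q : evA (word_at L q) = lval L (pt q).
Proof.
rewrite /word_at /lval; elim: L => [|e L IH] /=.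
  by rewrite eval_nil big_nil.
rewrite big_cons /same_point -IH; case: asboolP => [->|/eqP/negPf->] //.
by rewrite eqxx /= eval_cat.
Qed.

Definition eq_lval L M :=
  all (fun e => eqA (word_at L e.1) (word_at M e.1)) (L ++ M).

Lemma eq_lvalP L M : reflect (lval L =1 lval M) (eq_lval L M).
Proof.
apply: (iffP allP) => [LM p|LM e _]; last first.
  by apply/asboolP; rewrite !eval_word_at LM.
have LME e : e \in L ++ M -> lval L (pt e.1) = lval M (pt e.1).
  by move=> /LM/asboolP; rewrite !eval_word_at.
have [/lval_notin[e eL <-]|/contrapT L1] := pselect (lval L p <> 1).
  by apply: LME; rewrite mem_cat eL.
have [/lval_notin[e eM <-]|/contrapT ->//] := pselect (lval M p <> 1).
by apply: LME; rewrite mem_cat eM orbT.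
Qed.

(* In (w, L), the word w gives the top component and lval L the base component. *)
Definition parse_letter (l : letter) (x : WB * seq entry) : WB * seq entry :=
  match l.1 with
  | inl j => ((j, l.2) :: x.1, x.2)
  | inr (j, k) => (x.1, ((k, x.1), [:: (j, l.2)]) :: x.2)
  end.

Definition parse (w : seq letter) := foldr parse_letter ([::], [::]) w.

Lemma base_deltaE p (a : A) p' : base_delta p a p' = if p == p' then a else 1.
Proof. by rewrite fsfunE in_fset1 eq_sym. Qed.

(** The base component of [y * x] is that of [y] translated by the top of [x], times that of [x]. A
    base letter at [s k] therefore contributes at the image of [s k] under the top of the remaining
    word, which is why parsing runs from the right. *)
Lemma parseP (w : seq letter) :
  let x := eval_word (wr_gen act genA genB s) w in
  wr_top x = evB (parse w).1 /\ wr_base x =1 lval (parse w).2.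
Proof.
elim: w => [|[l eps] w [IH1 IH2]] /=.
  rewrite !eval_nil; split=> // p; rewrite /lval big_nil.
  exact: base_oneE.
rewrite eval_cons /=; set x := eval_word _ w in IH1 IH2 *.
case: l => [j|[j k]] /=.
  split.
    rewrite eval_cons -IH1; case: eps => //=.
  move=> p; rewrite -IH2.
  have -> : forall y : wreath A act, wr_base (y * x) p =
      wr_base y (act p (wr_top x)^-1) * wr_base x p.
    by move=> y; rewrite base_mulE base_actE.
  case: eps; last by rewrite base_oneE mul1g.
  by rewrite base_invE base_actE base_oneE invg1 mul1g.
split; first by rewrite -IH1; case: eps; rewrite /= ?invg1 mul1g.
move=> p; rewrite /lval big_cons -/(lval _ _) -IH2.
have -> : forall y : wreath A act, wr_base (y * x) p =
    wr_base y (act p (wr_top x)^-1) * wr_base x p.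
  by move=> y; rewrite base_mulE base_actE.
have -> : (pt (k, (parse w).1) == p) = (s k == act p (wr_top x)^-1).
  rewrite /pt /= -IH1; apply/eqP/eqP => [<-|->]; first by rewrite actK.
  by rewrite actVK.
have -> : evA [:: (j, eps)] = if eps then (genA j)^-1 else genA j.
  by rewrite eval_cons eval_nil mulg1.
case: eps; rewrite ?base_invE ?base_actE base_deltaE ?invgK ?invg1 ?ract1;
  by case: eqP; rewrite ?invg1 ?mul1g.
Qed.

Definition same_orbit_pt c q r := `[< same_orbit act (evB c) (pt q) (pt r) >].

(** Entries at one point could multiply to something else, even to 1; the clause on [word_at] makes
    each entry carry the full value at its point. *)
Definition normal_form c L := all (fun e =>
  [&& ~~ eqA e.2 [::], eqA (word_at L e.1) e.2 &
      all (fun e' => same_orbit_pt c e.1 e'.1 ==> same_point e.1 e'.1) L]) L.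

Lemma normal_formP c L : normal_form c L ->
  (forall e, e \in L -> lval L (pt e.1) = evA e.2 /\ evA e.2 <> 1) /\
  separated act (evB c) (lval L).
Proof.
move=> /allP nf; split=> [e /nf/and3P[/asboolPn e1 /asboolP e2 _]|p p'].
  by rewrite -eval_word_at e2; split=> // e1'; apply: e1; rewrite eval_nil.
move=> /lval_notin[e eL <-] /lval_notin[e' e'L <-].
have /and3P[_ _ /allP/(_ e' e'L)/implyP H] := nf e eL.
by move=> /asboolT/H/asboolP.
Qed.

(* All ways to pair each entry of L with some entry of M. *)
Definition zips L M : seq (seq (entry * entry)) :=
  foldr (fun e Zs => flatten [seq [seq (e, e') :: Z | Z <- Zs] | e' <- M]) [:: [::]] L.

Lemma zips_total L M Z e : Z \in zips L M -> e \in L ->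
  exists2 e', e' \in M & (e, e') \in Z.
Proof.
elim: L Z => //= e0 L IH Z /flatten_mapP[e' e'M /mapP[Z' Z'L ->]].
rewrite inE => /orP[/eqP ->|eL]; first by exists e'; rewrite // inE eqxx.
by have [e2 e2M eZ'] := IH _ Z'L eL; exists e2; rewrite // inE eZ' orbT.
Qed.

Lemma zips_exists L M (R : entry -> entry -> Prop) :
  (forall e, e \in L -> exists2 e', e' \in M & R e e') ->
  exists2 Z, Z \in zips L M & forall z, z \in Z -> R z.1 z.2.
Proof.
elim: L => [|e L IH] H; first by exists [::].
have [e' e'M Re] := H e (mem_head _ _).
have [|Z ZL RZ] := IH; first by move=> e1 e1L; apply: H; rewrite inE e1L orbT.
exists ((e, e') :: Z).
  by apply/flatten_mapP; exists e' => //; apply: map_f.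
by move=> z; rewrite inE => /orP[/eqP ->|/RZ].
Qed.

Definition slot_match c (z : entry * entry) :=
  `[< slot_equiv act (evB c) (pt z.1.1) (evA z.1.2) (evA z.2.2) >].

(** A pair of points [s_k alpha], [s_k gamma] yields the pair [(alpha, gamma)] of (iv): [alpha * d]
    lies in [H_k gamma <c>] exactly when [d] carries the first point into the orbit of the
    second. *)
Definition coset_pairs (Z : seq (entry * entry)) : m.-tuple (seq (WB * WB)) :=
  [tuple [seq (z.1.1.2, z.2.1.2) | z <- Z & z.1.1.1 == k] | k < m].

Definition no_centralising c (ps : m.-tuple (seq (WB * WB))) : bool :=
  `[< (\bigcap_(k in [set: 'I_m]) Gamma act (s k) (evB c)
        [seq (evB w.1, evB w.2) | w <- tnth ps k] = set0)%classic >].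

Definition realisable c (Z : seq (entry * entry)) :=
  all (fun z => (z.1.1.1 == z.2.1.1) && slot_match c z) Z &&
  ~~ no_centralising c (coset_pairs Z).

(** Instead of a bijection of orbits, a choice of partners for [L] in [M] and one for [M] in [L] are
    tested together, so that a single [d] serves both. For normal forms this amounts to a bijection,
    each orbit being met at most once. *)
Definition orbit_matching c L M :=
  has (fun Z => has (fun Z' => realisable c (Z ++ [seq (z.2, z.1) | z <- Z']))
                    (zips M L)) (zips L M).

(** This turns (iii) into a test for lying on a common orbit, and for [b = 1] into a test for
    equality of points. *)
Lemma double_coset_orbit p (g b w : B) :
  double_coset act p g b w <-> same_orbit act b (act p g) (act p w).
Proof.
rewrite same_orbit_cyclic; split=> [[h ph [c bc <-]]|[c bc e]].
  by exists c; rewrite // !ractM ph.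
exists (w * c^-1 * g^-1); last by exists c => //; rewrite !mulgVK.
by rewrite /stabiliser /= !ractM -e actK -ractM mulgV ract1.
Qed.

Lemma same_orbit1 p p' : same_orbit act 1 p p' <-> p = p'.
Proof.
split=> [[i [j]]|->]; last exact: same_orbit_refl.
by rewrite !expg1n !ract1.
Qed.

Hypothesis orbS : orbit_representatives act s.

Lemma same_orbit_index (b : B) k l x y :
  same_orbit act b (act (s k) x) (act (s l) y) -> k = l.
Proof.
move=> /same_orbit_cyclic[c _ e].
have [j [_ j_uniq]] := orbS (act (s l) y).
rewrite -(j_uniq k); first by apply: j_uniq; exists y.
by exists (x * c); rewrite ractM.
Qed.

Lemma realisableP c Z : realisable c Z <-> exists2 d, commute d (evB c) &
  forall z, z \in Z -> slot_match c z /\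
    same_orbit act (evB c) (act (pt z.1.1) d) (pt z.2.1).
Proof.
rewrite /realisable /no_centralising.
have tE k : tnth (coset_pairs Z) k =
    [seq (z.1.1.2, z.2.1.2) | z <- Z & z.1.1.1 == k] by rewrite tnth_mktuple.
split=> [/andP[/allP Zm /asboolPn/eqP/set0P[d dG]]|[d dc Zd]].
  have dZ z : z \in Z -> commute d (evB c) /\
      same_orbit act (evB c) (act (pt z.1.1) d) (pt z.2.1).
    move=> zZ; have /andP[/eqP zk _] := Zm z zZ.
    have [dGk dc] := dG z.1.1.1 I; split=> //.
    have /= := dGk (evB z.1.1.2, evB z.2.1.2).
    case; last move=> w /double_coset_orbit ow dE.
      by rewrite tE; apply/mapP; exists (z.1.1.2, z.2.1.2) => //;
        apply/mapP; exists z; rewrite // mem_filter eqxx.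
    apply: same_orbit_sym; rewrite /pt -zk -ractM -dE mulVKg.
    exact: ow.
  (* For [m = 0] the intersection is all of [B] and [d] may fail to centralise. Then [Z] is empty,
     and for empty [Z] the element 1 serves. *)
  case: Z Zm dZ {dG tE} => [|z0 Z] Zm dZ.
    by exists 1 => //; apply/commute_sym/commute1.
  exists d; first by have [] := dZ z0 (mem_head _ _).
  by move=> z zZ; have /andP[_ ->] := Zm z zZ; have [] := dZ z zZ.
apply/andP; split.
  apply/allP => z zZ; have [-> oz] := Zd z zZ; rewrite andbT; apply/eqP.
  by move: oz; rewrite /pt -ractM => /same_orbit_index.
apply/asboolPn/eqP/set0P; exists d => k _; split=> //= -[al ga] /=.
rewrite tE => /mapP[w /mapP[z zf ->] [-> ->]] /=.
move: zf; rewrite mem_filter => /andP[/eqP zk zZ].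
have [_ oz] := Zd z zZ.
exists (evB z.1.1.2 * d); last by rewrite mulKg.
apply/double_coset_orbit/same_orbit_sym; move: oz; rewrite /pt -ractM => oz.
by have e := same_orbit_index oz; rewrite -zk {2}e.
Qed.

Lemma orbit_matchingP c L M : normal_form c L -> normal_form c M ->
  orbit_matching c L M <-> exists2 d, commute d (evB c) &
    base_conj act (evB c) (fun p => lval L (act p d^-1)) (lval M).
Proof.
move=> /normal_formP[vL sepL] /normal_formP[vM sepM].
split=> [/hasP[Z ZLM /hasP[Z' ZML /realisableP[d dc Zd]]]|[d dc]].
  exists d => //; apply/(base_conj_shift (lval_finite L)) => //; split.
    move=> p /lval_notin[e eL <-].
    have [e' e'M eZ] := zips_total ZLM eL.
    have [|/asboolP em eo] := Zd (e, e'); first by rewrite mem_cat eZ.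
    have [-> e1] := vL e eL; have [e'E e'1] := vM e' e'M.
    by exists (pt e'.1); rewrite e'E.
  move=> p /lval_notin[e eM <-].
  have [e' e'L eZ] := zips_total ZML eM.
  have [|_ eo] := Zd (e', e).
    by rewrite mem_cat; apply/orP; right; apply/mapP; exists (e, e').
  by have [e'E e'1] := vL e' e'L; exists (pt e'.1); rewrite ?e'E.
move=> /(base_conj_shift (lval_finite L) sepL sepM dc)[LM ML].
pose R e e' := slot_match c (e, e') /\
  same_orbit act (evB c) (act (pt e.1) d) (pt e'.1).
have LR e : e \in L -> exists2 e', e' \in M & R e e'.
  move=> eL; have [eE e1] := vL e eL.
  have [|q [/lval_notin[e' e'M <-] qo]] := LM (pt e.1); first by rewrite eE.
  rewrite eE; have [-> e'1] := vM e' e'M => qm.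
  by exists e' => //; split=> //; apply/asboolP.
have MR e : e \in M -> exists2 e', e' \in L & R e' e.
  move=> eM; have [eE e1] := vM e eM.
  have [|p /lval_notin[e' e'L <-] eo] := ML (pt e.1); first by rewrite eE.
  (* Surjectivity gives only the orbit. The matching of values comes from the partner [e2] of [e'],
     which sits at the same point as [e] because [M] is separated. *)
  exists e' => //; have [e2 e2M [m2 o2]] := LR e' e'L; split=> //.
  have e2E : pt e2.1 = pt e.1.
    have [e2E e21] := vM e2 e2M.
    apply: sepM; rewrite ?e2E ?eE //.
    exact: same_orbit_trans (same_orbit_sym o2) eo.
  by move: m2; rewrite /slot_match /= -(vM e2 e2M).1 e2E eE.
have [Z ZLM ZR] := zips_exists LR.
have [Z' ZML Z'R] := zips_exists MR.
apply/hasP; exists Z => //; apply/hasP; exists Z' => //; apply/realisableP.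
exists d => // z; rewrite mem_cat => /orP[/ZR//|/mapP[z' /Z'R z'R ->]].
exact: z'R.
Qed.

(** * Existence and soundness of certificates *)

Hypothesis surjA : forall x : A, exists w, evA w = x.
Hypothesis surjB : forall x : B, exists w, evB w = x.

Lemma pt_surj p : exists q, pt q = p.
Proof.
have [k [[x ->] _]] := orbS p; have [w <-] := surjB x.
by exists (k, w).
Qed.

(** Words for points and values are picked by classical choice; this is harmless, as certificates
    only have to exist for the search to find them. *)
Lemma lval_surj f : finitely_supported f -> exists2 L, lval L =1 f &
  forall e, e \in L -> f (pt e.1) = evA e.2 /\ evA e.2 <> 1.
Proof.
move=> [P fP].
pose P0 := undup [seq p <- P | f p != 1].
pose point_of p := projT1 (cid (pt_surj p)).
have ptE p : pt (point_of p) = p by rewrite /point_of; case: cid.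
pose word_of x := projT1 (cid (surjA x)).
have wordE x : evA (word_of x) = x by rewrite /word_of; case: cid.
exists [seq (point_of p, word_of (f p)) | p <- P0]; last first.
  move=> e /mapP[p]; rewrite mem_undup mem_filter => /andP[/eqP fp _] ->.
  by rewrite /= ptE wordE.
move=> p; rewrite /lval big_map.
under eq_bigl do rewrite ptE.
under eq_bigr do rewrite wordE.
have [pP|pP] := boolP (p \in P0).
  have E : [seq i <- P0 | i == p] = [:: p].
    by rewrite -[RHS](filter_pred1_uniq (undup_uniq _) pP).
  by rewrite -big_filter E big_seq1.
rewrite big_seq_cond big1 => [|i /andP[iP /eqP ip]]; last by rewrite -ip iP in pP.
apply: contrapT => fp; have f1 : f p <> 1 by move/esym.
by case/negP: pP; rewrite mem_undup mem_filter fP // andbT; apply/eqP.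
Qed.

Local Notation cert := (WB * ((seq entry * seq entry) * (seq entry * seq entry)))%type.
Implicit Types (t : cert).

Definition eqB b c := `[< evB b = evB c >].

(* For x = (b, f) and y = (c, g), the certificate t = (d, ((h, f'), (h', g')))
   is valid when (d, 1)(1, h) conjugates x to (c, f'), (1, h') conjugates y to
   (c, g'), and f' and g' are in normal form. *)
Definition valid (x y : WB * seq entry) t :=
  [&& eqB (x.1 ++ t.1) (t.1 ++ y.1),
      eq_lval (shift x.2 t.1 ++ t.2.1.1) (shift t.2.1.1 y.1 ++ t.2.1.2),
      eq_lval (y.2 ++ t.2.2.1) (shift t.2.2.1 y.1 ++ t.2.2.2),
      normal_form y.1 t.2.1.2 & normal_form y.1 t.2.2.2].

Lemma eq_lval_base_conj b L M (H : seq entry) :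
  eq_lval (L ++ H) (shift H b ++ M) -> base_conj act (evB b) (lval L) (lval M).
Proof.
move=> /eq_lvalP LM; exists (lval H); first exact: lval_finite.
by move=> p; rewrite -lval_cat LM lval_cat lval_shift.
Qed.

Lemma base_conj_eq_lval b L (f : S -> A) : finitely_supported f ->
    separated act (evB b) f -> base_conj act (evB b) (lval L) f ->
  exists H M, eq_lval (L ++ H) (shift H b ++ M) /\ normal_form b M.
Proof.
move=> ffin fsep [h hfin Lhf].
have [H HE _] := lval_surj hfin; have [M ME Mf] := lval_surj ffin.
exists H, M; split.
  by apply/eq_lvalP => p; rewrite !lval_cat lval_shift !HE ME Lhf.
apply/allP => e eM; have [fe e1] := Mf e eM; apply/and3P; split.
- by apply/asboolP; rewrite eval_nil.
- by apply/asboolP; rewrite eval_word_at ME.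
apply/allP => e' e'M; have [fe' e'1] := Mf e' e'M.
by apply/implyP => /asboolP o; apply/asboolP/fsep; rewrite ?fe ?fe'.
Qed.

Lemma valid_exists x y (d : B) : evB x.1 * d = d * evB y.1 -> exists t, valid x y t.
Proof.
have [w <-] := surjB d => E.
have [f ffin [fsep fc]] := base_conj_separated act (evB y.1) (lval_finite (shift x.2 w)).
have [g gfin [gsep gc]] := base_conj_separated act (evB y.1) (lval_finite y.2).
have [H [M [HM nM]]] := base_conj_eq_lval ffin fsep fc.
have [H' [M' [HM' nM']]] := base_conj_eq_lval gfin gsep gc.
exists (w, ((H, M), (H', M'))); apply/and5P; split=> //.
by apply/asboolP; rewrite !eval_cat.
Qed.

Lemma valid_conj (u v : seq letter) t : valid (parse u) (parse v) t ->
  (exists z, eval_word (wr_gen act genA genB s) v =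
             eval_word (wr_gen act genA genB s) u ^ z) <->
  orbit_matching (parse v).1 t.2.1.2 t.2.2.2.
Proof.
have [uE1 uE2] := parseP u; have [vE1 vE2] := parseP v.
move: t => [d [[H M] [H' M']]] /and5P[/asboolP/= bd uM vM nM nM'].
rewrite !eval_cat in bd.
rewrite wreath_conjP vE1 uE1 (funext uE2 : _ = lval _) (funext vE2 : _ = lval _).
rewrite (orbit_matchingP nM nM').
have {}uM := eq_lval_base_conj uM; have {}vM := eq_lval_base_conj vM.
have shiftE (e : B) : commute e (evB (parse v).1) ->
    base_conj act (evB (parse v).1)
      (fun p => lval (parse u).2 (act p (evB d * e)^-1))
      (fun p => lval M (act p e^-1)).
  move=> ec; have := base_conj_translate ec uM.
  by congr base_conj; apply/funext => p; rewrite lval_shift invgM ractM.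
split=> [[e' be' uv]|[e ec MM']].
  (* Both [e'] and [evB d] conjugate one top component into the other, so they differ by an element
     of the centraliser. *)
  pose e : B := (evB d)^-1 * e'; have e'E : e' = evB d * e by rewrite mulVKg.
  have ec : commute e (evB (parse v).1).
    apply: (mulgI (evB d)); rewrite mulgA -e'E -be' e'E !mulgA bd //.
  exists e => //.
  apply: base_conj_trans (base_conj_sym (shiftE e ec)) _.
  by rewrite -e'E; apply: base_conj_trans vM.
exists (evB d * e); first by rewrite mulgA bd -!mulgA ec.
exact: base_conj_trans (base_conj_trans (shiftE e ec) MM') (base_conj_sym vM).
Qed.


(** * Computability of the certificate check and of the matching test *)

Hypothesis conjA : conjugacy_problem_solvable genA.
Hypothesis conjB : conjugacy_problem_solvable genB.
Hypothesis abelian_or_orbit_order :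
  (forall x y : A, commute x y) \/ orbit_order_problem_solvable act genB s.
Hypothesis membership : forall k : 'I_m, double_coset_membership_solvable act genB s k.
Hypothesis intersection : Gamma_intersection_problem_solvable act genB s.

Definition conj_words (n : nat) (G : groupType) (gen : 'I_n -> G) (u v : seq ('I_n * bool)) :=
  `[< exists x, eval_word gen v = eval_word gen u ^ x >].

Lemma comp_conj_words n (G : groupType) (gen : 'I_n -> G) T
    (f g : T -> seq ('I_n * bool)) : conjugacy_problem_solvable gen ->
  computable f -> computable g -> computable (fun x => conj_words gen (f x) (g x)).
Proof.
move=> /decidable_computable cG cf cg.
exact: (comp_comp (f := fun x => (f x, g x)) cG (comp_pair cf cg)).
Qed.

(** The word problem is an instance of the conjugacy problem, because only 1 is conjugate to 1. *)
Lemma comp_eq_words n (G : groupType) (gen : 'I_n -> G) T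
    (f g : T -> seq ('I_n * bool)) : conjugacy_problem_solvable gen ->
  computable f -> computable g ->
  computable (fun x => `[< eval_word gen (f x) = eval_word gen (g x) >]).
Proof.
move=> cG cf cg.
apply: (comp_ext (f := fun x => conj_words gen (f x ++ inverse_word (g x)) [::])).
  move=> x; apply: asbool_equiv_eq; rewrite eval_nil eval_cat eval_inverse.
  split=> [[y]|->]; last by exists 1; rewrite mulgV conj1g.
  by move/esym/eqP; rewrite conjg_eq1 => /eqP/divg1_eq.
apply: comp_conj_words => //; last exact: comp_const.
apply: comp_cat => //; apply: (comp_map (h := fun _ l => (l.1, ~~ l.2))).
  by apply: (comp_finfun (fun l => (l.1, ~~ l.2))); comp_auto.
exact: comp_rev.
Qed.

(** Points on one [b]-orbit have the same index, so comparing indices first leaves a single instance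
    of (iii). *)
Lemma comp_same_orbit T (f : T -> WB) (g h : T -> point) :
  computable f -> computable g -> computable h ->
  computable (fun x => same_orbit_pt (f x) (g x) (h x)).
Proof.
move=> cf cg ch.
pose F k x := `[< double_coset act (s k) (evB (g x).2) (evB (f x)) (evB (h x).2) >].
apply: (comp_ext (f := fun x => ((g x).1 == (h x).1) && F (g x).1 x)).
  move=> x; rewrite /same_orbit_pt /F.
  apply/andP/asboolP => [[/eqP e /asboolP/double_coset_orbit]|o].
    by rewrite {2}e.
  have e := same_orbit_index o; rewrite e eqxx; split=> //.
  by apply/asboolP/double_coset_orbit; rewrite -{1}e.
apply: comp_andb; first by apply: (comp_fin2 (fun i j => i == j)); comp_auto.
apply: comp_case; last by comp_auto.
move=> k; have /decidable_computable cm := membership k.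
apply: (comp_comp (f := fun x => ((g x).2, f x, (h x).2)) cm).
by comp_auto.
Qed.

Lemma comp_same_point T (g h : T -> point) :
  computable g -> computable h -> computable (fun x => same_point (g x) (h x)).
Proof.
move=> cg ch; apply: (comp_ext (f := fun x => same_orbit_pt [::] (g x) (h x))).
  by move=> x; apply: asbool_equiv_eq; rewrite eval_nil same_orbit1.
by apply: comp_same_orbit => //; apply: comp_const.
Qed.

Lemma comp_word_at T (f : T -> seq entry) (g : T -> point) :
  computable f -> computable g -> computable (fun x => word_at (f x) (g x)).
Proof.
move=> cf cg; apply/comp_flatten/(comp_map (h := fun _ e => e.2)); first by comp_auto.
apply: (comp_filter (p := fun x e => same_point e.1 (g x))) => //.
apply: comp_same_point; first by comp_auto.
by apply: (comp_comp (f := fst) cg); comp_auto.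
Qed.

Lemma comp_eqA T (f g : T -> WA) :
  computable f -> computable g -> computable (fun x => eqA (f x) (g x)).
Proof. exact: comp_eq_words. Qed.

Lemma comp_eq_lval T (f g : T -> seq entry) :
  computable f -> computable g -> computable (fun x => eq_lval (f x) (g x)).
Proof.
move=> cf cg.
apply: (comp_all (p := fun x e => eqA (word_at (f x) e.1) (word_at (g x) e.1)));
  last exact: comp_cat.
by apply: comp_eqA; apply: comp_word_at; comp_auto;
  [apply: (comp_comp (f := fst) cf) | apply: (comp_comp (f := fst) cg)]; comp_auto.
Qed.

Lemma comp_shift T (f : T -> seq entry) (g : T -> WB) :
  computable f -> computable g -> computable (fun x => shift (f x) (g x)).
Proof.
move=> cf cg.
apply: (comp_map (h := fun x e => ((e.1.1, e.1.2 ++ g x), e.2))) => //.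
comp_auto; apply: comp_cat; comp_auto.
by apply: (comp_comp (f := fst) cg); comp_auto.
Qed.

Lemma comp_normal_form T (f : T -> WB) (g : T -> seq entry) :
  computable f -> computable g -> computable (fun x => normal_form (f x) (g x)).
Proof.
move=> cf cg.
apply: (comp_all (p := fun x e => [&& ~~ eqA e.2 [::], eqA (word_at (g x) e.1) e.2 &
   all (fun e' => same_orbit_pt (f x) e.1 e'.1 ==> same_point e.1 e'.1) (g x)])) => //.
have cg1 : computable (fun y : T * entry => g y.1).
  by apply: (comp_comp (f := fst) cg); comp_auto.
apply: comp_andb; first by apply/comp_negb/comp_eqA; comp_auto.
apply: comp_andb.
  by apply: comp_eqA; [apply: comp_word_at|]; comp_auto.
apply: (comp_all (p := fun y e' =>
  same_orbit_pt (f y.1) y.2.1 e'.1 ==> same_point y.2.1 e'.1)) => //.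
apply: (comp_fin2 (implb)).
  apply: comp_same_orbit; comp_auto.
  by apply: (comp_comp (f := fun y => y.1.1) cf); comp_auto.
by apply: comp_same_point; comp_auto.
Qed.

Lemma comp_zips T (f g : T -> seq entry) :
  computable f -> computable g -> computable (fun x => zips (f x) (g x)).
Proof.
move=> cf cg; rewrite /zips; comp_auto.
apply/comp_flatten/(comp_map (h := fun y e' => [seq (y.2.1, e') :: Z | Z <- y.2.2])).
  by apply: (comp_map (h := fun y Z => (y.1.2.1, y.2) :: Z)); comp_auto.
by apply: (comp_comp (f := fst) cg); comp_auto.
Qed.

(** Hypothesis (ii) enters here. For abelian [A] conjugate values are equal, so the kind of orbit is
    irrelevant; otherwise its finiteness selects between conjugacy and equality. *)
Lemma comp_slot_match T (f : T -> WB) (g : T -> entry * entry) :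
  computable f -> computable g -> computable (fun x => slot_match (f x) (g x)).
Proof.
move=> cf cg.
have ce : computable (fun x => eqA (g x).1.2 (g x).2.2).
  by apply: comp_eqA; comp_auto.
have [abA|/decidable_computable oop] := abelian_or_orbit_order.
  apply: comp_ext ce => x; apply: asbool_equiv_eq.
  split=> [->|[[u ->] _]]; first by split=> //; exists 1; rewrite conjg1.
  by rewrite conjgE abA mulgK.
pose per x := `[< periodic act (evB (f x)) (pt (g x).1.1) >].
apply: (comp_ext (f := fun x => if per x then conj_words genA (g x).1.2 (g x).2.2
                                else eqA (g x).1.2 (g x).2.2)).
  move=> x; rewrite /per; case: asboolP => pp; apply: asbool_equiv_eq.
    by split=> [cj|[]].
  split=> [->|[_ /(_ pp)->]] //.
  by split=> //; exists 1; rewrite conjg1.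
apply: comp_if => //; last by apply: comp_conj_words => //; comp_auto.
apply: (comp_ext (f := fun x => `[< cardinality.finite_set
   (cyclic_orbit act (evB (f x)) (pt (g x).1.1)) >])).
  by move=> x; apply: asbool_equiv_eq; apply: finite_orbit_periodic.
apply: (comp_comp (f := fun x => (f x, (g x).1.1)) oop).
by comp_auto.
Qed.

Lemma comp_tuple T (X : countType) n (F : 'I_n -> T -> X) :
  (forall i, computable (F i)) -> computable (fun x => [tuple F i x | i < n]).
Proof.
move=> cF; suff [G rG GP] : computable (fun x => [seq F i x | i <- enum 'I_n]).
  (* A tuple has the same code as its underlying list. *)
  by exists G.
apply: (comp_map (h := fun x i => F i x)); last exact: comp_const.
apply: (comp_case (F := fun i y => F i y.1)); last by comp_auto.
by move=> i; apply: (comp_comp (f := fst) (cF i)); comp_auto.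
Qed.

Lemma comp_realisable T (f : T -> WB) (g : T -> seq (entry * entry)) :
  computable f -> computable g -> computable (fun x => realisable (f x) (g x)).
Proof.
move=> cf cg; apply: comp_andb.
  apply: (comp_all (p := fun x z => (z.1.1.1 == z.2.1.1) && slot_match (f x) z)) => //.
  apply: comp_andb; first by apply: (comp_fin2 (fun i j => i == j)); comp_auto.
  by apply: comp_slot_match; comp_auto; apply: (comp_comp (f := fst) cf); comp_auto.
apply: comp_negb; have /decidable_computable ci := intersection.
apply: (comp_comp (f := fun x => (f x, coset_pairs (g x))) ci).
comp_auto; apply: comp_tuple => k.
apply: (comp_map (h := fun _ z => (z.1.1.2, z.2.1.2))); first by comp_auto.
apply: (comp_filter (p := fun _ z => z.1.1.1 == k)) => //.
by apply: (comp_finfun (fun i => i == k)); comp_auto.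
Qed.

Lemma comp_orbit_matching T (f : T -> WB) (g h : T -> seq entry) :
  computable f -> computable g -> computable h ->
  computable (fun x => orbit_matching (f x) (g x) (h x)).
Proof.
move=> cf cg ch.
apply: (comp_has (p := fun x Z =>
    has (fun Z' => realisable (f x) (Z ++ [seq (z.2, z.1) | z <- Z']))
      (zips (h x) (g x)))); last exact: comp_zips.
apply: (comp_has (p := fun y Z' =>
    realisable (f y.1) (y.2 ++ [seq (z.2, z.1) | z <- Z']))); last first.
  by apply: comp_zips; [apply: (comp_comp (f := fst) ch) |
    apply: (comp_comp (f := fst) cg)]; comp_auto.
apply: comp_realisable; first by apply: (comp_comp (f := fun y => y.1.1) cf); comp_auto.
apply: comp_cat; first by comp_auto.
by apply: (comp_map (h := fun _ z => (z.2, z.1))); comp_auto.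
Qed.

Lemma comp_valid T (f g : T -> WB * seq entry) (h : T -> cert) :
  computable f -> computable g -> computable h ->
  computable (fun x => valid (f x) (g x) (h x)).
Proof.
move=> cf cg ch; apply: comp_andb.
  by apply: comp_eq_words => //; apply: comp_cat; comp_auto.
apply: comp_andb.
  by apply: comp_eq_lval; apply: comp_cat; try apply: comp_shift; comp_auto.
apply: comp_andb.
  by apply: comp_eq_lval; apply: comp_cat; try apply: comp_shift; comp_auto.
by apply: comp_andb; apply: comp_normal_form; comp_auto.
Qed.

Lemma comp_parse T (f : T -> seq letter) :
  computable f -> computable (fun x => parse (f x)).
Proof.
move=> cf; apply: (comp_foldr (g := fun _ => parse_letter)) => //; last exact: comp_const.
apply: (comp_case (F := fun l y => parse_letter l y.2.2)); last by comp_auto.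
by move=> [[j|[j k]] eps]; rewrite /parse_letter /=; comp_auto.
Qed.

Lemma wreath_conjugacy_solvable :
  conjugacy_problem_solvable (wr_gen act genA genB s).
Proof.
pose cB (i : seq letter * seq letter) := conj_words genB (parse i.1).1 (parse i.2).1.
(* When the top components are not conjugate, every certificate is accepted so that the search still
   ends; [D] then answers negatively. *)
pose V i (t : cert) := ~~ cB i || valid (parse i.1) (parse i.2) t.
pose D i (t : cert) := cB i && orbit_matching (parse i.2).1 t.2.1.2 t.2.2.2.
have effB : effective WB by apply/effective_seq/effective_fin.
have effE : effective (seq entry).
  apply/effective_seq/effective_pair; last exact/effective_seq/effective_fin.
  by apply: effective_pair => //; apply: effective_fin.
have effW : effective (seq letter) by apply/effective_seq/effective_fin.
have ccB T (f : T -> seq letter * seq letter) : computable f -> computable (fun x => cB (f x)).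
  by move=> cf; apply: comp_conj_words => //; comp_auto; apply: comp_parse; comp_auto.
apply: (decidable_search (V := V) (D := D)).
- exact: effective_pair.
- by apply: effective_pair => //; apply: effective_pair; apply: effective_pair.
- apply: comp_orb; first by apply: comp_negb; apply: ccB; comp_auto.
  by apply: comp_valid; [apply: comp_parse | apply: comp_parse |]; comp_auto.
- apply: comp_andb; first by apply: ccB; comp_auto.
  by apply: comp_orbit_matching; [comp_auto; apply: comp_parse| |]; comp_auto.
- move=> i; rewrite /V; case: (boolP (cB i)) => [/asboolP[d e]|_]; last first.
    by exists ([::], (([::], [::]), ([::], [::]))).
  by apply: (@valid_exists _ _ d); rewrite e conjgC.
move=> i t; rewrite /V /D; case: (boolP (cB i)) => [_ /valid_conj //|/asboolPn ncB _].
split=> // -[z e]; case: ncB; exists (wr_top z).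
have [<- _] := parseP i.1; have [<- _] := parseP i.2.
by rewrite e.
Qed.

End Program.

Local Open Scope group_scope.

Theorem theorem1p0p4
  (A B : groupType)
  (ntA : exists x : A, x <> 1) (ntB : exists x : B, x <> 1)
  (nA nB : nat) (genA : 'I_nA -> A) (genB : 'I_nB -> B)
  (presA : recursive_presentation genA) (presB : recursive_presentation genB)
  (S : choiceType) (act : right_action B S)
  (m : nat) (s : 'I_m -> S) (orbS : orbit_representatives act s)
  (conjA : conjugacy_problem_solvable genA)
  (conjB : conjugacy_problem_solvable genB)
  (abelian_or_orbit_order :
     (forall x y : A, commute x y) \/ orbit_order_problem_solvable act genB s)
  (membership : forall k : 'I_m, double_coset_membership_solvable act genB s k)
  (intersection : Gamma_intersection_problem_solvable act genB s) :
  conjugacy_problem_solvable (wr_gen act genA genB s).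
Proof.
case: presA => _ _ [surjA _]; case: presB => _ _ [surjB _].
exact: wreath_conjugacy_solvable.
Qed.
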